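(* Let $p,q\ge1$ be integers and let $\psi\in L^2(\mu^p)$ and $\varphi\in L^2(\mu^q)$ be degenerate, symmetric kernels of orders $p$ and $q$, respectively. Let $n\ge p$ and $m\ge q$ be integers with $m\ge n$. Then, whenever $n\ge p+q$, we have the Hoeffding decomposition $$J_p^{(n)}(\psi)\,J_q^{(m)}(\varphi)=\sum_{\substack{M\subseteq[m]:\\ |M|\le p+q}}U_M=\sum_{k=|p-q|}^{p+q}\ \sum_{s=0}^{q\wedge k\wedge(m-n)}\ \sum_{\substack{M\subseteq[m]:\ |M|=k,\\ |M\cap\{n+1,\dots,m\}|=s}}U_M,$$ where, for $M\subseteq[m]$ with $0\le k:=|M|\le p+q$ and $0\le s:=|M\cap\{n+1,\dots,m\}|\le q\wedge k\wedge(m-n)$, the Hoeffding component $U_M$ is given by $$U_M=\sum_{r=\lceil\frac{p+q-k}{2}\rceil}^{p\wedge(q-s)\wedge(p+q-k)}\binom{n-k+s}{p+q-r-k}\sum_{(A,B,C)\in\Pi_{r,n,m}(M)}\bigl(\psi\star_r^{p+q-r-k}\varphi\bigr)_M\bigl((X_i)_{i\in A},(X_i)_{i\in B},(X_i)_{i\in C}\bigr).$$ Moreover, for such $M$, $$\sqrt{\operatorname{Var}(U_M)}\le\sum_{r=\lceil\frac{p+q-k}{2}\rceil}^{p\wedge(q-s)\wedge(p+q-k)}\binom{n-k+s}{p+q-r-k}\binom{k-s}{2r+k-p-q,\;p-r,\;q-r-s}\,\bigl\|\psi\star_r^{p+q-r-k}\varphi\bigr\|_{L^2(\mu^k)} 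.$$
   Context: $X_1,X_2,\dots$ are i.i.d. random variables with values in a measurable space $(E,\mathcal E)$ and common distribution $\mu$; $\mu^k$ is the $k$-fold product measure. $[m]=\{1,\dots,m\}$ and $\mathcal D_k(n)$ is the collection of all $k$-element subsets of $[n]$. For a symmetric kernel $\psi$ of order $p$, $J_p^{(n)}(\psi)=\sum_{1\le i_1<\dots<i_p\le n}\psi(X_{i_1},\dots,X_{i_p})$; $\psi$ is degenerate if $\int_E\psi(x_1,x_2,\dots,x_p)\,d\mu(x_1)=0$ for $\mu^{p-1}$-a.a. $(x_2,\dots,x_p)$. Hoeffding decomposition of a random variable $T$ that is a function of $X_1,\dots,X_m$: a representation $T=\sum_{M\subseteq[m]}U_M$ in which $U_M$ is $\sigma(X_i,i\in M)$-measurable and, writing $\mathcal F_L=\sigma(X_j,j\in L)$, $\mathbb E[U_M\mid\mathcal F_L]=0$ whenever $M\not\subseteq L$. Contractions. For $0\le l\le r\le p\wedge q$, $$(\psi\star_r^l\varphi)(y_1,\dots,y_{r-l},t_1,\dots,t_{p-r},s_1,\dots,s_{q-r}):=\mathbb E\bigl[\psi(X_1,\dots,X_l,y_1,\dots,y_{r-l},t_1,\dots,t_{p-r})\,\varphi(X_1,\dots,X_l,y_1,\dots,y_{r-l},s_1,\dots,s_{q-r})\bigr]$$ whenever the right-hand side is well-defined and finite, and $0$ otherwise (for $l=0$ there is no integration). Thus $\psi\star_r^{p+q-r-k}\varphi$ is a function on $E^k$. Its $L^2$-norm may be $+\infty$. Canonical components. For $f\in L^1(\mu^k)$ and $M$ with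 $|M|=k$, $(f)_M$ denotes the top-order component of the Hoeffding decomposition of the (not necessarily symmetric) function $f$, i.e. $$(f)_M(x_1,\dots,x_k)=\sum_{K\subseteq[k]}(-1)^{k-|K|}\int_{E^{k-|K|}}f(x_1,\dots,x_k)\,d\mu^{k-|K|}\bigl((x_i)_{i\in[k]\setminus K}\bigr).$$ In $(X_i)_{i\in A}$ the indices appear in increasing order; the $|A|+|B|+|C|=k$ entries are plugged in consecutively as arguments. Index sets. For nonnegative integers $l,n,m,r$ with $n\le m$, $r\le p\wedge q$, $l\ge p+q-2r$ and $L\subseteq[m]$ with $|L|=l$, $\Pi_{r,n,m}(L)$ is the collection of all triples $(A,B,C)\in\mathcal D_{2r+l-p-q}(n)\times\mathcal D_{p-r}(n)\times\mathcal D_{q-r}(m)$ such that $L$ is the disjoint union of $A$, $B$ and $C$. $\binom{N}{a,b,c}=\frac{N!}{a!\,b!\,c!}$ (with $a+b+c=N$) is the multinomial coefficient. Empty sums are $0$. *)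

(* Defs.v *)
From HB Require Import structures.
From mathcomp Require Import all_boot all_order all_algebra perm.
From mathcomp Require Import all_classical all_reals all_analysis.

Set Implicit Arguments.
Unset Strict Implicit.
Unset Printing Implicit Defensive.

Import Order.TTheory GRing.Theory Num.Theory.
Import numFieldNormedType.Exports.

Local Open Scope classical_set_scope.
Local Open Scope ring_scope.

Section PowerMeasure.
Context d (E : measurableType d).

Definition consp n (z : E * n.-tuple E) : n.+1.-tuple E := [tuple of z.1 :: z.2].

Lemma measurable_consp n : measurable_fun setT (@consp n).
Proof. exact: measurable_cons. Qed.

HB.instance Definition _ n :=
  isMeasurableFun.Build _ _ _ _ (@consp n) (@measurable_consp n).

Context (R : realType) (mu : probability E R).

(* The product measure mu^n on E^n. *)
Fixpoint power_prob (n : nat) : probability (n.-tuple E) R :=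
  if n is n'.+1
  then distribution (mu \x power_prob n')%E (@consp n')
  else dirac ([tuple] : 0.-tuple E).

Lemma measurable_box n (A : 'I_n -> set E) :
  (forall i, measurable (A i)) ->
  measurable [set t : n.-tuple E | forall i, A i (tnth t i)].
Proof.
move=> mA.
rewrite (_ : [set t | _] = \big[setI/setT]_(i < n) ((@tnth n E)^~ i @^-1` A i)).
  apply: bigsetI_measurable => i _; rewrite -[X in measurable X]setTI.
  exact: measurable_tnth.
apply/seteqP; split => t /=.
  move=> tA; apply: (big_ind (fun B : set (n.-tuple E) => B t)) => //.
  by move=> i _; exact: tA.
by move=> tA i; move: tA; rewrite (bigD1 i)//= => -[].
Qed.

Lemma power_prob_box n (A : 'I_n -> set E) :
  (forall i, measurable (A i)) ->
  power_prob n [set t | forall i, A i (tnth t i)] = (\prod_(i < n) mu (A i))%E.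
Proof.
elim: n A => [|n IH] A mA /=.
  by rewrite big_ord0 diracE mem_set//= => -[].
rewrite /distribution /pushforward /=.
rewrite (_ : _ @^-1` _ = A ord0 `*`
  [set t : n.-tuple E | forall i, A (lift ord0 i) (tnth t i)]); last first.
  apply/seteqP; split => -[x t] /=.
    move=> xtA; split=> [|i]; first exact: (xtA ord0).
    by have := xtA (lift ord0 i); rewrite /consp tnthS.
  move=> [xA tA] i; case: (unliftP ord0 i) => [j ->|->]; last exact: xA.
  by rewrite /consp tnthS.
pose B i := A (lift ord0 i) : set E.
have mB i : measurable (B i) by exact: mA.
rewrite product_measure1E; [|exact: mA|exact: (measurable_box mB)].
by rewrite big_ord_recl -(IH B mB).
Qed.

End PowerMeasure.

Section Kernels.
Context d (E : measurableType d) (R : realType) (mu : probability E R).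

(* The sequence s seen as a point of E^k.  It is only meaningful, and only
   used, when size s = k; the default value of nth is then irrelevant. *)
Definition pt k (s : seq E) : k.-tuple E := [tuple nth point s i | i < k].

Definition symmetric_kernel p (psi : p.-tuple E -> R) : Prop :=
  forall (g : 'S_p) (x : p.-tuple E), psi [tuple tnth x (g i) | i < p] = psi x.

Definition degenerate p (psi : p.-tuple E -> R) : Prop :=
  {ae power_prob mu p.-1, forall t : p.-1.-tuple E,
     (\int[mu]_x (psi (pt p (x :: t)))%:E)%E = 0%E}.

(* The contraction psi *_r^l phi, a function on E^k with k = p + q - r - l; its
   argument z lists y_1, .., y_(r-l), then t_1, .., t_(p-r), then
   s_1, .., s_(q-r).  A real-valued integral is 0 when its extended real value
   is infinite or when the positive and negative parts both have infinite
   integral, as the convention for contractions requires. *)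
Definition kernel_contraction p q (psi : p.-tuple E -> R) (phi : q.-tuple E -> R)
    (r l k : nat) (z : k.-tuple E) : R :=
  let y := take (r - l) z in
  let t := take (p - r) (drop (r - l) z) in
  let s := drop (p - r) (drop (r - l) z) in
  \int[power_prob mu l]_x (psi (pt p (x ++ y ++ t)) * phi (pt q (x ++ y ++ s))).

(* The point of E^k with the coordinates of x at the positions in K and the
   entries of w, in increasing order, at the other positions. *)
Definition fill k (K : {set 'I_k}) (x : k.-tuple E) (w : seq E) : k.-tuple E :=
  [tuple if i \in K then tnth x i
         else nth point w (index i (enum (~: K)%SET)) | i < k].

(* (f)_M, which depends on M only through k = #|M| *)
Definition top_component k (f : k.-tuple E -> R) (x : k.-tuple E) : R :=
  \sum_(K : {set 'I_k}) (-1) ^+ (k - #|K|) *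
     \int[power_prob mu (k - #|K|)]_w f (fill K x w).

End Kernels.

Arguments kernel_contraction {d E R} mu {p q} psi phi r l k z.

Section Indices.

(* [m] = {1, .., m} is 'I_m and X_1, X_2, .. is X 0, X 1, ..: the index i is
   shifted to i - 1, so that [n] and {n + 1, .., m} become the two sets below. *)
Definition initial_seg m n : {set 'I_m} := [set i : 'I_m | (i < n)%N]%SET.
Definition final_seg m n : {set 'I_m} := [set i : 'I_m | (n <= i)%N]%SET.

Definition ksubsets m (k n : nat) : {set {set 'I_m}} :=
  [set A : {set 'I_m} | (A \subset initial_seg m n) && (#|A| == k)]%SET.

(* Pi_{r,n,m}(L), meant for n <= m, r <= minn p q and #|L| >= p + q - 2r, so that
   no subtraction is truncated. *)
Definition triples (p q r n m : nat) (L : {set 'I_m}) :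
    {set {set 'I_m} * {set 'I_m} * {set 'I_m}} :=
  [set T : {set 'I_m} * {set 'I_m} * {set 'I_m} |
    let: (A, B, C) := T in
    [&& A \in ksubsets m (2 * r + #|L| - p - q) n,
        B \in ksubsets m (p - r) n,
        C \in ksubsets m (q - r) m,
        [disjoint A & B], [disjoint A & C], [disjoint B & C] &
        (A :|: B :|: C)%SET == L]]%SET.

Definition multinomial3 (R : realType) (N a b c : nat) : R :=
  N`!%:R / (a`! * b`! * c`!)%:R.

End Indices.

Section Statistics.
Context dO (Omega : measurableType dO) d (E : measurableType d) (R : realType).
Context (P : probability Omega R) (mu : probability E R).
Implicit Type X : nat -> {RV P >-> E}.

Definition mutually_independent X : Prop :=
  forall (s : seq nat) (A : nat -> set E), uniq s ->
    (forall i, measurable (A i)) ->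
    P (\bigcap_(i in [set` s]) (X i @^-1` A i)) =
    (\prod_(i <- s) P (X i @^-1` A i))%E.

Definition iid X : Prop :=
  mutually_independent X /\
  (forall i (A : set E), measurable A -> distribution P (X i) A = mu A).

Definition sigma_of X m (L : {set 'I_m}) : set (set Omega) :=
  <<s \bigcup_(i in [set` L])
        preimage_set_system setT (X (nat_of_ord i)) measurable >>.

(* V is a version of the conditional expectation E[U | G]. *)
Definition is_cond_exp (G : set (set Omega)) (U V : Omega -> R) : Prop :=
  [/\ U \in Lfun P 1, V \in Lfun P 1,
      forall B : set R, measurable B -> G (V @^-1` B) &
      forall A, G A -> (\int[P]_(w in A) (U w)%:E = \int[P]_(w in A) (V w)%:E)%E].

Definition Hoeffding_decomposition X m (T : Omega -> R)
    (U : {set 'I_m} -> Omega -> R) : Prop :=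
  [/\ {ae P, forall w, T w = \sum_(M : {set 'I_m}) U M w},
      forall (M : {set 'I_m}) (B : set R), measurable B ->
        sigma_of X M (U M @^-1` B) &
      forall M L : {set 'I_m}, ~~ (M \subset L) ->
        is_cond_exp (sigma_of X L) (U M) (cst 0)].

Definition Jstat X n p (psi : p.-tuple E -> R) (w : Omega) : R :=
  \sum_(i : p.-tuple 'I_n | sorted (fun a b : 'I_n => (a < b)%N) i)
     psi [tuple X (tnth i j) w | j < p].

(* (X_i)_(i in A): enum lists A in increasing order *)
Definition sample X m (A : {set 'I_m}) (w : Omega) : seq E :=
  [seq X (nat_of_ord i) w | i <- enum A].

(* U_M; it is 0 outside the range of M for which the formula is given. *)
Definition product_component X p q (psi : p.-tuple E -> R)
    (phi : q.-tuple E -> R) (n m : nat) (M : {set 'I_m}) (w : Omega) : R :=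
  let k := #|M| in
  let s := #|(M :&: final_seg m n)%SET| in
  if (k <= p + q)%N && (s <= minn q (minn k (m - n)))%N then
    \sum_(uphalf (p + q - k) <= r < (minn p (minn (q - s) (p + q - k))).+1)
      'C(n - k + s, p + q - r - k)%:R *
      \sum_(T in triples p q r n M)
         top_component mu
           (kernel_contraction mu psi phi r (p + q - r - k) k)
           (pt k (sample X T.1.1 w ++ sample X T.1.2 w ++ sample X T.2 w))
  else 0.

End Statistics.

(* Main.v *)
(** Everything is transported to the product space E^m.  The conditional
    expectation given (X_i), i in K, becomes
    [condE K h x = \int h (x on K, y off K) dmu^m(y)], and since exchanging
    coordinates between the two copies x and y preserves mu^m x mu^m, these
    operators are self-adjoint.  Moebius inversion over subsets gives the
    projections [hproj M] onto Hoeffding components.  Applied to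
    psi(X_I) phi(X_J), degeneracy kills [hproj M] unless
    I symdiff J <= M <= I u J, and for such M the conditional expectation given
    (X_i), i in M, is the contraction evaluated at A = I n J n M, B = I \ J,
    C = J \ I.  It does not depend on D = (I n J) \ M, which ranges over the
    subsets of [n] \ M of size p + q - r - k: this is the binomial factor.
    The variance bound is Minkowski's inequality, because [hproj M] is a
    contraction of L^2 and the triples (A, B, C) are at most as many as the
    multinomial coefficient. *)
Require Import Defs.
From HB Require Import structures.
From mathcomp Require Import all_boot all_order all_algebra perm.
From mathcomp Require Import all_classical all_reals all_analysis.
From mathcomp Require Import measurable_realfun ring zify.

Set Implicit Arguments.
Unset Strict Implicit.
Unset Printing Implicit Defensive.

Import Order.TTheory GRing.Theory Num.Theory.
Import numFieldNormedType.Exports.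

Local Open Scope classical_set_scope.
Local Open Scope ring_scope.

(** * Measure-preserving maps *)

Section MeasurePreserving.
Context {R : realType}.

(** Since I and J may overlap, square integrability of the kernels only makes psi(X_I) phi(X_J)
    integrable, by Cauchy-Schwarz. At exceptional points the integral defining [condE K h] may
    diverge and take the value 0, so rules such as the tower property hold only almost everywhere.
    They are proved by testing against indicators and moving [condE] onto the bounded test function.
    For the same reason orthogonality of projections is stated for every pair [b], [h] to which
    Fubini applies. Bounded [b] with integrable [h] yields vanishing conditional expectations; two
    functions in L^2 yield the contraction property behind the variance bound. The assumption p + q
    <= n enters twice: it gives k <= n, so that [n] \ M has n - k + s elements, and it makes the
    binomial factors positive, so that a contraction of infinite norm makes the variance bound
    infinite. *)

Definition measure_preserving d1 d2 (T1 : measurableType d1)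
    (T2 : measurableType d2) (m1 : {measure set T1 -> \bar R})
    (m2 : {measure set T2 -> \bar R}) (f : T1 -> T2) :=
  measurable_fun setT f /\
  forall A, measurable A -> m1 (f @^-1` A) = m2 A.

Lemma measure_preserving_comp d1 d2 d3 (T1 : measurableType d1)
    (T2 : measurableType d2) (T3 : measurableType d3)
    (m1 : {measure set T1 -> \bar R}) (m2 : {measure set T2 -> \bar R})
    (m3 : {measure set T3 -> \bar R}) (f : T1 -> T2) (g : T2 -> T3) :
  measure_preserving m1 m2 f -> measure_preserving m2 m3 g ->
  measure_preserving m1 m3 (g \o f).
Proof.
move=> [mf fE] [mg gE]; split; first exact: measurableT_comp.
move=> A mA; rewrite comp_preimage fE ?gE//.
by rewrite -[X in measurable X]setTI; exact: mg.
Qed.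

Context d1 d2 (T1 : measurableType d1) (T2 : measurableType d2).
Context (m1 : {measure set T1 -> \bar R}) (m2 : {measure set T2 -> \bar R}).
Context (f : T1 -> T2) (fP : measure_preserving m1 m2 f).

Lemma measure_preserving_ge0_integral (g : T2 -> \bar R) :
  measurable_fun setT g -> (forall y, 0 <= g y)%E ->
  (\int[m2]_y g y = \int[m1]_x g (f x))%E.
Proof.
case: fP => mf fE mg g0.
have -> : (\int[m2]_y g y = \int[pushforward m1 f]_y g y)%E.
  by apply: eq_measure_integral => A mA _; rewrite /= -fE.
by rewrite ge0_integral_pushforward// preimage_setT.
Qed.

Lemma measure_preserving_integral (g : T2 -> \bar R) :
  measurable_fun setT g -> (\int[m2]_y g y = \int[m1]_x g (f x))%E.
Proof.
move=> mg; rewrite integralE [RHS]integralE.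
rewrite (@measure_preserving_ge0_integral (g^\+)%E)
  ?(@measure_preserving_ge0_integral (g^\-)%E).
- by rewrite -[fun x => g (f x)]/(g \o f) (funepos_comp g f) (funeneg_comp g f).
- exact: measurable_funeneg.
- exact: funeneg_ge0.
- exact: measurable_funepos.
- exact: funepos_ge0.
Qed.

Lemma measure_preserving_Rintegral (g : T2 -> R) :
  measurable_fun setT g -> \int[m2]_y g y = \int[m1]_x g (f x).
Proof.
move=> mg; rewrite /Rintegral measure_preserving_integral//.
exact/measurable_EFinP.
Qed.

Lemma measure_preserving_integrable (g : T2 -> \bar R) :
  m2.-integrable setT g -> m1.-integrable setT (g \o f).
Proof.
case/integrableP=> mg; case: (fP) => mf _ goo; apply/integrableP; split.
  exact: measurableT_comp.
have mag : measurable_fun setT (abse \o g) by exact: measurableT_comp.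
rewrite -[X in (X < _)%E](measure_preserving_ge0_integral mag) => [|y].
  exact: goo.
exact: abse_ge0.
Qed.

Lemma measure_preserving_ae (Q : T2 -> Prop) :
  {ae m2, forall y, Q y} -> {ae m1, forall x, Q (f x)}.
Proof.
case: fP => mf fE [A [mA A0 QA]]; exists (f @^-1` A); split.
- by rewrite -[X in measurable X]setTI; exact: mf.
- by rewrite fE.
- by move=> x Qx; exact: QA.
Qed.

Lemma measure_preserving_Lnorm (g : T2 -> R) (r : R) :
  measurable_fun setT g ->
  ('N[m1]_r%:E[EFin \o (g \o f)] = 'N[m2]_r%:E[EFin \o g])%E.
Proof.
move=> mg; rewrite unlock /Lnorm.
rewrite (@measure_preserving_ge0_integral (fun x => `|(EFin \o g) x| `^ r)%E)//.
  apply: (measurableT_comp (measurable_poweR r)).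
  exact/measurableT_comp/measurable_EFinP.
by move=> y; exact: poweR_ge0.
Qed.

Lemma measure_preserving_Lfun (g : T2 -> R) (r : R) :
  g \in Lfun m2 r%:E -> g \o f \in Lfun m1 r%:E.
Proof.
move=> /andP[]; rewrite !inE/= => mg gr; apply/andP; split; rewrite inE/=.
  by case: fP => mf _; exact: measurableT_comp.
by rewrite /finite_norm measure_preserving_Lnorm.
Qed.

End MeasurePreserving.

(** * Coordinate maps on product spaces *)

Section Coordinates.
Context d (E : measurableType d) (R : realType) (mu : probability E R).
Local Notation Q := (power_prob mu).

(** Preimages of measurable sets under one coordinate are not stable under intersection; boxes are,
    so two probabilities that agree on boxes coincide. *)
Lemma measurable_tupleE n :
  (measurable : set (set (n.-tuple E))) =
  <<s [set B | exists2 A : 'I_n -> set E, forall i, measurable (A i) &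
          B = [set t : n.-tuple E | forall i, A i (tnth t i)]] >>.
Proof.
apply/seteqP; split; last first.
  apply: smallest_sub; first exact: sigma_algebra_measurable.
  by move=> _ [A mA ->]; exact: measurable_box.
apply: smallest_sub; first exact: smallest_sigma_algebra.
move=> B; elim/big_ind: _ => //; first by move=> X Y hX hY [/hX|/hY].
move=> i _ [A mA <-]; apply: sub_sigma_algebra.
exists (fun j => if j == i then A else setT) => [j|]; first by case: ifP.
apply/seteqP; split => t /=.
  by move=> [_ At] j; case: ifPn => // /eqP ->.
by move=> /(_ i); rewrite eqxx.
Qed.

Lemma tuple_measure_unique n (m1 m2 : probability (n.-tuple E) R) :
  (forall A : 'I_n -> set E, (forall i, measurable (A i)) ->
    m1 [set t | forall i, A i (tnth t i)] =
    m2 [set t | forall i, A i (tnth t i)]) ->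
  forall B, measurable B -> m1 B = m2 B.
Proof.
move=> m12 B mB.
apply: (measure_unique _ (fun=> setT) (measurable_tupleE n)) => //.
- move=> _ _ [A mA ->] [A' mA' ->]; exists (fun i => A i `&` A' i).
    by move=> i; exact: measurableI.
  apply/seteqP; split => t /=; first by move=> [At A't] i.
  by move=> AA't; split=> i; have [] := AA't i.
- by move=> _; exists (fun=> setT) => //; apply/seteqP; split.
- by apply/seteqP; split => // x _; exists 0%N.
- by move=> _ [A mA ->]; exact: m12.
- by move=> _; rewrite -ge0_fin_numE// fin_num_measure.
Qed.

Definition coords l m (s : 'I_l -> 'I_m) (x : m.-tuple E) : l.-tuple E :=
  [tuple tnth x (s i) | i < l].

Lemma tnth_coords l m (s : 'I_l -> 'I_m) x i :
  tnth (coords s x) i = tnth x (s i).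
Proof. by rewrite tnth_mktuple. Qed.

Lemma measurable_coords l m (s : 'I_l -> 'I_m) :
  measurable_fun setT (coords s).
Proof.
apply/measurable_fun_tnthP => i.
rewrite (_ : _ \o _ = fun x => tnth x (s i)); first exact: measurable_tnth.
by apply/funext => x /=; rewrite tnth_coords.
Qed.

Lemma coords_measure_preserving l m (s : 'I_l -> 'I_m) : injective s ->
  measure_preserving (Q m) (Q l) (coords s).
Proof.
move=> sI; split; first exact: measurable_coords.
pose f : {mfun m.-tuple E >-> l.-tuple E} :=
  HB.pack (coords s) (isMeasurableFun.Build _ _ _ _ _ (measurable_coords s)).
move=> B mB; rewrite -[LHS]/(distribution (Q m) f B).
apply: tuple_measure_unique mB => A mA.
rewrite [RHS]power_prob_box// /= /distribution/= /pushforward/=.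
(* The intersection of the [A i] with [s i = j]: a single set by injectivity, and the whole space,
   of measure 1, when [j] is not a value of [s]. *)
pose A' j := [set e | forall i, s i = j -> A i e].
have A's i : A' (s i) = A i.
  by apply/seteqP; split => e; [exact|move=> Ae i' /sI ->].
have A'T j : j \notin codom s -> A' j = setT.
  move=> js; apply/seteqP; split => e // _ i sij.
  by move: js; rewrite -sij codom_f.
rewrite (_ : _ @^-1` _ = [set t | forall j, A' j (tnth t j)]); last first.
  apply/seteqP; split => t /= At => [j i <-|i].
    by have := At i; rewrite tnth_coords.
  by rewrite tnth_coords; exact: At.
rewrite power_prob_box => [|j]; last first.
  by have [/codomP[i ->]|/A'T ->//] := boolP (j \in codom s); rewrite A's.
rewrite (bigID (mem (codom s)))/= [X in (_ * X)%E]big1 ?mule1; last first.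
  by move=> j /A'T ->; rewrite probability_setT.
rewrite -big_uniq/=; last by rewrite map_inj_uniq ?enum_uniq.
by rewrite big_image/=; apply: eq_bigr => i _; rewrite A's.
Qed.

Definition cat_pair m m' (z : m.-tuple E * m'.-tuple E) : (m + m').-tuple E :=
  [tuple of z.1 ++ z.2].

Lemma cat_pair_measure_preserving m m' :
  measure_preserving (Q m \x Q m')%E (Q (m + m')) (@cat_pair m m').
Proof.
have mcat : measurable_fun setT (@cat_pair m m').
  apply/measurable_fun_tnthP => i; rewrite -(splitK i).
  case: (fintype.split i) => j /=.
    rewrite (_ : _ \o _ = (fun x => tnth x j) \o fst).
      exact: (measurableT_comp (measurable_tnth j) measurable_fst).
    by apply/funext => x /=; rewrite tnth_lshift.
  rewrite (_ : _ \o _ = (fun x => tnth x j) \o snd).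
    exact: (measurableT_comp (measurable_tnth j) measurable_snd).
  by apply/funext => x /=; rewrite tnth_rshift.
split=> //.
pose f : {mfun (m.-tuple E * m'.-tuple E)%type >-> (m + m').-tuple E} :=
  HB.pack (@cat_pair m m') (isMeasurableFun.Build _ _ _ _ _ mcat).
move=> B mB; rewrite -[LHS]/(distribution (Q m \x Q m')%E f B).
apply: tuple_measure_unique mB => A mA.
rewrite [RHS]power_prob_box// /= /distribution/= /pushforward/=.
rewrite (_ : _ @^-1` _ = [set t | forall j, A (lshift m' j) (tnth t j)] `*`
                         [set t | forall j, A (rshift m j) (tnth t j)]).
  have mAl := measurable_box (fun j => mA (lshift m' j)).
  have mAr := measurable_box (fun j => mA (rshift m j)).
  rewrite product_measure1E; [|exact: mAl|exact: mAr].
  rewrite big_split_ord/=; congr (_ * _)%E.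
    exact: (power_prob_box mu (fun j => mA (lshift m' j))).
  exact: (power_prob_box mu (fun j => mA (rshift m j))).
apply/seteqP; split => -[x y] /= At.
  split=> j; first by have := At (lshift m' j); rewrite tnth_lshift.
  by have := At (rshift m j); rewrite tnth_rshift.
move=> i; rewrite -(splitK i); case: At => Ax Ay.
by case: (fintype.split i) => j /=; rewrite ?tnth_lshift ?tnth_rshift.
Qed.

Definition split_pair m m' (z : (m + m').-tuple E) :=
  (coords (@lshift m m') z, coords (@rshift m m') z).

(** [cat_pair] preserves the measures and [split_pair] undoes it. *)
Lemma split_pair_measure_preserving m m' :
  measure_preserving (Q (m + m')) (Q m \x Q m')%E (@split_pair m m').
Proof.
have ms : measurable_fun setT (@split_pair m m').
  by apply: measurable_fun_pair; exact: measurable_coords.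
split=> // A mA; have [mc cE] := cat_pair_measure_preserving m m'.
rewrite -cE; last by rewrite -[X in measurable X]setTI; exact: ms.
rewrite -comp_preimage (_ : _ \o _ = id)//; apply/funext => -[x y] /=.
rewrite /split_pair; congr pair; apply/eq_from_tnth => i.
  by rewrite tnth_coords tnth_lshift.
by rewrite tnth_coords tnth_rshift.
Qed.

Definition splice m (K : {set 'I_m}) (x y : m.-tuple E) : m.-tuple E :=
  [tuple if i \in K then tnth x i else tnth y i | i < m].

Lemma tnth_splice m (K : {set 'I_m}) x y i :
  tnth (splice K x y) i = if i \in K then tnth x i else tnth y i.
Proof. by rewrite tnth_mktuple. Qed.

Definition swap_off m (K : {set 'I_m}) (z : m.-tuple E * m.-tuple E) :=
  (splice K z.1 z.2, splice K z.2 z.1).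

(** After concatenation the exchange is a permutation of the 2m coordinates, the involution [s]
    below, and every injective selection of coordinates preserves power measures. *)
Lemma swap_off_measure_preserving m (K : {set 'I_m}) :
  measure_preserving (Q m \x Q m)%E (Q m \x Q m)%E (swap_off K).
Proof.
pose s (u : 'I_(m + m)) := match fintype.split u with
  | inl i => if i \in K then lshift m i else rshift m i
  | inr i => if i \in K then rshift m i else lshift m i
  end.
have sl i : s (lshift m i) = if i \in K then lshift m i else rshift m i.
  by rewrite /s -[lshift m i]/(unsplit (inl i)) unsplitK.
have sr i : s (rshift m i) = if i \in K then rshift m i else lshift m i.
  by rewrite /s -[rshift m i]/(unsplit (inr i)) unsplitK.
have sK : involutive s.
  move=> u; rewrite -(splitK u); case: (fintype.split u) => i /=.
    by rewrite sl; case: ifPn => iK; rewrite ?sl ?sr ?iK ?(negbTE iK).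
  by rewrite sr; case: ifPn => iK; rewrite ?sl ?sr ?iK ?(negbTE iK).
rewrite (_ : swap_off K = @split_pair m m \o (coords s \o @cat_pair m m)).
  apply: measure_preserving_comp; last exact: split_pair_measure_preserving.
  apply: measure_preserving_comp; first exact: cat_pair_measure_preserving.
  exact/coords_measure_preserving/inv_inj.
apply/funext => -[x y]; rewrite /swap_off/split_pair/=; congr pair.
  apply/eq_from_tnth => i; rewrite tnth_splice 2!tnth_coords sl.
  by case: ifP => iK; rewrite ?tnth_lshift ?tnth_rshift.
apply/eq_from_tnth => i; rewrite tnth_splice 2!tnth_coords sr.
by case: ifP => iK; rewrite ?tnth_lshift ?tnth_rshift.
Qed.

Lemma fst_measure_preserving d1 d2 (T1 : measurableType d1)
    (T2 : measurableType d2) (P1 : probability T1 R) (P2 : probability T2 R) :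
  measure_preserving (P1 \x P2)%E P1 fst.
Proof.
split=> // A mA; rewrite (_ : _ @^-1` _ = A `*` setT).
  transitivity (P1 A * P2 setT)%E; first exact: product_measure1E.
  by rewrite probability_setT mule1.
by apply/seteqP; split => -[x y] //= [].
Qed.

(** The spliced point is the first half of the exchanged pair. *)
Lemma splice_measure_preserving m (K : {set 'I_m}) :
  measure_preserving (Q m \x Q m)%E (Q m) (fun z => splice K z.1 z.2).
Proof.
exact: (measure_preserving_comp (swap_off_measure_preserving K)
                                (fst_measure_preserving _ _)).
Qed.

End Coordinates.

Lemma sample_measure_preserving (R : realType) dO (Omega : measurableType dO)
    (P : probability Omega R) d (E : measurableType d) (mu : probability E R)
    (X : nat -> {RV P >-> E}) m : iid mu X ->
  measure_preserving P (power_prob mu m) (fun w => [tuple X i w | i < m]).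
Proof.
move=> [Xind XE].
have mX : measurable_fun setT (fun w => [tuple X i w | i < m]).
  apply/measurable_fun_tnthP => i; rewrite (_ : _ \o _ = X i) //.
  by apply/funext => w /=; rewrite tnth_mktuple.
split=> // B mB.
pose f : {mfun Omega >-> m.-tuple E} :=
  HB.pack (fun w => [tuple X i w | i < m])
          (isMeasurableFun.Build _ _ _ _ _ mX).
rewrite -[LHS]/(distribution P f B).
apply: tuple_measure_unique mB => A mA.
rewrite [RHS]power_prob_box// /= /distribution/= /pushforward/=.
(* Independence is stated for sets indexed by all naturals, so the family on 'I_m is extended by the
   whole space. *)
pose A' j := if insub j is Some i then A i else setT.
have A'E (i : 'I_m) : A' i = A i by rewrite /A' valK.
have mA' j : measurable (A' j) by rewrite /A'; case: insubP.
rewrite (_ : _ @^-1` _ = \bigcap_(j in [set` iota 0 m]) (X j @^-1` A' j)).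
  rewrite Xind ?iota_uniq// -[in iota _ m](subn0 m) big_mkord.
  by apply: eq_bigr => i _; rewrite -A'E; exact: XE.
apply/seteqP; split => w /= Aw.
  move=> j /=; rewrite mem_iota/= add0n => jm.
  by have := Aw (Ordinal jm); rewrite tnth_mktuple -A'E.
move=> i; rewrite tnth_mktuple -A'E; apply: Aw => /=.
by rewrite mem_iota/= add0n.
Qed.

(** * Real-valued integrals *)

Section RealIntegrals.
Context d (T : measurableType d) (R : realType) (m : {measure set T -> \bar R}).

Implicit Types (f g b : T -> R) (r C : R).

Definition integrable_real (f : T -> R) := m.-integrable setT (EFin \o f).

Lemma integrable_real_measurable f :
  integrable_real f -> measurable_fun setT f.
Proof. by case/integrableP => /measurable_EFinP. Qed.

(** For measurable [f] a finite integral forces integrability, and [fine] sends the infinite values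
    to 0. *)
Lemma Rintegral_not_integrable f :
  measurable_fun setT f -> ~ integrable_real f -> \int[m]_x f x = 0.
Proof.
move=> mf fN; rewrite /Rintegral.
have : (\int[m]_x (f x)%:E)%E \isn't a fin_num.
  apply/negP => foo; apply: fN; apply/integrableP; split.
    exact/measurable_EFinP.
  by rewrite integral_fin_num_abs.
by case: (\int[m]_x _)%E.
Qed.

(** Constants are pulled out of the sections y -> h (splice K x y) at every [x], including those
    where the section is not integrable and both sides are 0. *)
Lemma Rintegral_mull f r : measurable_fun setT f ->
  \int[m]_x (r * f x) = r * \int[m]_x f x.
Proof.
move=> mf; have [fi|fN] := pselect (integrable_real f).
  exact: RintegralZl.
have [->|r0] := eqVneq r 0.
  under eq_Rintegral do rewrite mul0r.
  by rewrite mul0r /Rintegral integral0.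
rewrite (Rintegral_not_integrable mf fN) mulr0 Rintegral_not_integrable//.
  exact: measurable_funM.
move=> rfi; apply: fN; rewrite /integrable_real.
rewrite (_ : _ \o _ = fun x => ((r^-1)%:E * (EFin \o (fun x => r * f x)%R) x)%E).
  exact: integrableZl.
by apply/funext => x /=; rewrite -EFinM mulKf.
Qed.

Lemma integrable_realD f g : integrable_real f -> integrable_real g ->
  integrable_real (fun x => f x + g x).
Proof. by move=> fi gi; exact: (integrableD _ fi gi). Qed.

Lemma integrable_realZ f r : integrable_real f ->
  integrable_real (fun x => r * f x).
Proof. by move=> fi; exact: (integrableZl _ r fi). Qed.

Lemma integrable_real_sum I (s : seq I) (P : pred I) (F : I -> T -> R) :
  (forall i, P i -> integrable_real (F i)) ->
  integrable_real (fun x => \sum_(i <- s | P i) F i x).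
Proof.
move=> Fi; have := @integrable_sum _ _ _ m setT measurableT _ s P _ Fi.
by congr integrable; apply/funext => x /=; rewrite sumEFin.
Qed.

Lemma Rintegral_sum I (s : seq I) (P : pred I) (F : I -> T -> R) :
  (forall i, P i -> integrable_real (F i)) ->
  \int[m]_x (\sum_(i <- s | P i) F i x) =
  \sum_(i <- s | P i) \int[m]_x F i x.
Proof.
move=> Fi; elim: s => [|i s IH].
  rewrite big_nil; under eq_Rintegral do rewrite big_nil.
  by rewrite /Rintegral integral0.
rewrite big_cons; under eq_Rintegral do rewrite big_cons.
case: ifPn => // Pi; rewrite -IH RintegralD//; first exact: Fi.
exact: integrable_real_sum.
Qed.

Lemma integrable_real_mul_bounded f b (C : R) :
  measurable_fun setT b -> (forall x, `|b x| <= C) -> integrable_real f ->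
  integrable_real (fun x => b x * f x).
Proof.
move=> mb bC fi; have mf := integrable_real_measurable fi.
apply: (le_integrable _ _ _ (integrable_realZ C fi)) => //.
  by apply/measurable_EFinP; exact: measurable_funM.
move=> x _; rewrite /= lee_fin !normrM ler_wpM2r//.
by rewrite (le_trans (bC x))// ler_norm.
Qed.

Lemma integrable_real_le f g :
  measurable_fun setT f -> (forall x, `|f x| <= g x) -> integrable_real g ->
  integrable_real f.
Proof.
move=> mf fg gi; apply: (le_integrable _ _ _ gi) => //.
  exact/measurable_EFinP.
by move=> x _; rewrite /= lee_fin (le_trans (fg x))// ler_norm.
Qed.

(** Turns an almost sure identity between conditional expectations into one between integrals, where
    self-adjointness can act on the indicator. *)
Lemma ae_eq_of_Rintegral f g : integrable_real f -> integrable_real g ->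
  (forall B, measurable B ->
     \int[m]_x (\1_B x * f x) = \int[m]_x (\1_B x * g x)) ->
  {ae m, forall x, f x = g x}.
Proof.
move=> fi gi fg.
have : ae_eq m setT (EFin \o f) (EFin \o g).
  apply: integral_ae_eq => //; first exact: measurable_int gi.
  move=> B _ mB.
  have E h : integrable_real h ->
      (\int[m]_(x in B) (EFin \o h) x = (\int[m]_x (\1_B x * h x))%:E)%E.
    move=> hi; rewrite /Rintegral fineK; last first.
      apply: integrable_fin_num => //.
      apply: (@integrable_real_mul_bounded h \1_B 1 _ _ hi) => // x.
      by rewrite indicE; case: (_ \in _); rewrite ?normr1 ?normr0.
    rewrite integral_mkcond; apply: eq_integral => x _.
    by rewrite patchE indicE; case: ifPn; rewrite ?mul1r ?mul0r.
  by rewrite !E// fg.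
by apply: filterS => x /(_ I) [].
Qed.

Lemma ae_eq_Rintegral f g : measurable_fun setT f -> measurable_fun setT g ->
  {ae m, forall x, f x = g x} -> \int[m]_x f x = \int[m]_x g x.
Proof.
move=> mf mg fg; rewrite /Rintegral; congr fine.
apply: ae_eq_integral => //; [exact/measurable_EFinP..|].
by apply: filterS fg => x -> _.
Qed.

End RealIntegrals.

Lemma measure_preserving_integrable_real (R : realType) d1 d2
    (T1 : measurableType d1) (T2 : measurableType d2)
    (m1 : {measure set T1 -> \bar R}) (m2 : {measure set T2 -> \bar R})
    (f : T1 -> T2) (g : T2 -> R) : measure_preserving m1 m2 f ->
  integrable_real m2 g -> integrable_real m1 (fun x => g (f x)).
Proof. by move=> fP gi; exact: (measure_preserving_integrable fP gi). Qed.

(** * Fubini's theorem for real-valued integrals *)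

Section RealFubini.
Context d1 d2 (T1 : measurableType d1) (T2 : measurableType d2).
Context (R : realType) (P1 : probability T1 R) (P2 : probability T2 R).

Lemma measurable_Rintegral (f : T1 * T2 -> R) : measurable_fun setT f ->
  measurable_fun setT (fun x => \int[P2]_y f (x, y)).
Proof.
move=> mf; apply: (@measurableT_comp _ _ _ _ _ _ fine).
  exact: fine_measurable.
have mE : measurable_fun setT (EFin \o f) by exact/measurable_EFinP.
rewrite (_ : (fun x => _) = (fun x => \int[P2]_y (EFin \o f)^\+ (x, y)) \-
                            (fun x => \int[P2]_y (EFin \o f)^\- (x, y)))%E.
  apply: emeasurable_funB; apply: measurable_fun_fubini_tonelli_F => //.
    exact: measurable_funepos.
  exact: measurable_funeneg.
apply/funext => x; rewrite integralE -[fun y => (f (x, y))%:E]/((EFin \o f) \o pair x).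
by rewrite (funepos_comp (EFin \o f)) (funeneg_comp (EFin \o f)).
Qed.

(** The inner real integral is dominated by the extended one, since [fine] replaces infinities by 0,
    and the two differ only on the null set where the latter is infinite. *)
Lemma Rfubini (f : T1 * T2 -> R) : integrable_real (P1 \x P2)%E f ->
  integrable_real P1 (fun x => \int[P2]_y f (x, y)) /\
  \int[P1]_x \int[P2]_y f (x, y) = \int[(P1 \x P2)%E]_z f z.
Proof.
move=> fi; have Fi := integrable_fubini_F fi.
have mF := measurable_Rintegral (integrable_real_measurable fi).
have ri : integrable_real P1 (fun x => \int[P2]_y f (x, y)).
  apply: (le_integrable _ _ _ Fi) => //; first exact/measurable_EFinP.
  move=> x _; rewrite /= /fubini_F /Rintegral /=.
  by case: (\int[P2]_y _)%E => [r||]; rewrite ?normr0 ?leey.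
split=> //; rewrite [in LHS]/Rintegral [in RHS]/Rintegral; congr fine.
rewrite -[RHS](integral12_prod_meas1 fi).
apply: ae_eq_integral => //; first exact/measurable_EFinP.
  exact: measurable_int Fi.
have := integrable_ae measurableT Fi; apply: filterS => x /(_ I) Ffin _.
by rewrite /= /Rintegral fineK.
Qed.

End RealFubini.

(** * Square-integrable functions and the variance *)

Section LTwoNorms.
Context d (T : measurableType d) (R : realType) (m : {measure set T -> \bar R}).
Implicit Types (f g : T -> R).

Lemma Lfun2_sqr_integrable f : f \in Lfun m 2%:E ->
  integrable_real m (fun x => f x ^+ 2).
Proof. exact: Lfun2_integrable_sqr. Qed.

Lemma Lnorm2E f : f \in Lfun m 2%:E ->
  'N[m]_2%:E[EFin \o f]%E = (Num.sqrt (\int[m]_x (f x ^+ 2)))%:E.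
Proof.
move=> f2; have fi := Lfun2_sqr_integrable f2.
rewrite unlock /Lnorm (eq_integral (fun x => (f x ^+ 2)%:E)); last first.
  by move=> x _; rewrite /= powR_mulrn// real_normK// num_real.
rewrite /Rintegral -[X in (X `^ _)%E]fineK; last exact: integrable_fin_num.
rewrite poweR_EFin powR12_sqrt//; apply: fine_ge0; apply: integral_ge0 => x _.
by rewrite lee_fin sqr_ge0.
Qed.

Lemma le_Lnorm2 f g : f \in Lfun m 2%:E -> g \in Lfun m 2%:E ->
  \int[m]_x (f x ^+ 2) <= \int[m]_x (g x ^+ 2) ->
  ('N[m]_2%:E[EFin \o f] <= 'N[m]_2%:E[EFin \o g])%E.
Proof. by move=> f2 g2 fg; rewrite !Lnorm2E// lee_fin ler_wsqrtr. Qed.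

Lemma Lfun2_scale f (c : R) : f \in Lfun m 2%:E ->
  (fun x => c * f x) \in Lfun m 2%:E.
Proof.
move=> f2; have := @Lfun_scale _ _ _ m f c 2 (ler1n _ _) f2.
by congr in_mem; apply/funext => x /=; rewrite mulrC.
Qed.

Lemma Lnorm2_scale f (c : R) : 0 <= c -> f \in Lfun m 2%:E ->
  ('N[m]_2%:E[EFin \o (fun x => c * f x)%R] = c%:E * 'N[m]_2%:E[EFin \o f])%E.
Proof.
move=> c0 f2; rewrite !Lnorm2E ?Lfun2_scale// -EFinM; congr EFin.
under eq_Rintegral do rewrite exprMn.
rewrite RintegralZl//; last exact: Lfun2_sqr_integrable.
by rewrite sqrtrM ?sqr_ge0// sqrtr_sqr ger0_norm.
Qed.

Lemma Lfun2_sum (I : Type) (s : seq I) (Pr : pred I) (F : I -> T -> R) :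
  (forall i, Pr i -> F i \in Lfun m 2%:E) ->
  (fun x => \sum_(i <- s | Pr i) F i x) \in Lfun m 2%:E /\
  ('N[m]_2%:E[EFin \o (fun x => \sum_(i <- s | Pr i) F i x)%R] <=
   \sum_(i <- s | Pr i) 'N[m]_2%:E[EFin \o F i])%E.
Proof.
move=> F2; elim: s => [|i s [IH2 IH]].
  rewrite big_nil (_ : (fun x => _) = cst 0); last first.
    by apply/funext => x; rewrite big_nil.
  rewrite (_ : EFin \o _ = cst 0%E)// Lnorm0//.
  by split => //; exact: (@LfunP _ _ _ m 2%:E (lee1n 2) (cst 0)).
rewrite big_cons; have [Pi|Pi] := boolP (Pr i); last first.
  rewrite (_ : (fun x => _) = fun x => \sum_(i <- s | Pr i) F i x)//.
  by apply/funext => x; rewrite big_cons (negbTE Pi).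
rewrite (_ : (fun x => _) = F i \+
    (fun x => \sum_(i <- s | Pr i) F i x)); last first.
  by apply/funext => x; rewrite big_cons Pi.
have [_ addL] := @Lfun_addr_closed _ _ _ m 2%:E (lee1n 2).
split; first by apply: addL => //; exact: F2.
have mfun2 f : f \in Lfun m 2%:E -> measurable_fun setT f.
  by move=> /andP[]; rewrite inE.
apply: (le_trans (eminkowski m (mfun2 _ (F2 _ Pi)) (mfun2 _ IH2) (lee1n 2))).
by rewrite leeD2l.
Qed.

End LTwoNorms.

Lemma sqrte_variance_le d (T : measurableType d) (R : realType)
    (P : probability T R) (f : T -> R) : f \in Lfun P 2%:E ->
  (sqrte 'V_P[f] <= 'N[P]_2%:E[EFin \o f])%E.
Proof.
move=> f2; rewrite Lnorm2E//.
have -> : 'V_P[f] = (fine 'V_P[f])%:E by rewrite fineK// variance_fin_num.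
rewrite /sqrte lee_fin ler_wsqrtr// -lee_fin fineK ?variance_fin_num//.
rewrite varianceE// unlock.
rewrite [X in (X - _)%E](_ : _ = (\int[P]_x (f x ^+ 2))%:E); last first.
  rewrite /Rintegral fineK//; apply: integrable_fin_num => //.
  exact: Lfun2_sqr_integrable.
by rewrite geeDl// leeNl oppe0; exact: sqre_ge0.
Qed.

(** For square-integrable [f] this is nonnegativity of the variance; otherwise the right-hand side
    is infinite. *)
Lemma sqr_Rintegral_le d (T : measurableType d) (R : realType)
    (P : probability T R) (f : T -> R) : measurable_fun setT f ->
  (((\int[P]_x f x) ^+ 2)%:E <= \int[P]_x (f x ^+ 2)%:E)%E.
Proof.
move=> mf; have [->|] := eqVneq (\int[P]_x (f x ^+ 2)%:E)%E +oo%E.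
  exact: leey.
rewrite -ltey => f2oo.
have f2 : f \in Lfun P 2%:E.
  apply/andP; split; rewrite inE//= /finite_norm unlock /Lnorm poweR_lty//.
  apply: le_lt_trans f2oo; rewrite le_eqVlt; apply/orP; left; apply/eqP.
  apply: eq_integral => x _; rewrite /= powR_mulrn//.
  by rewrite real_normK// num_real.
have := variance_ge0 P f; rewrite varianceE// !unlock.
have fi : (\int[P]_x (f x)%:E)%E \is a fin_num.
  apply: integrable_fin_num => //; apply/Lfun1_integrable.
  by apply: Lfun_subset12 f2; rewrite fin_num_measure.
rewrite -(fineK fi) -EFin_expe sube_ge0 //.
Qed.

(** * Conditional expectations on product spaces *)

Section ConditionalExpectation.
Context d (E : measurableType d) (R : realType) (mu : probability E R).
Variable m : nat.
Local Notation Q := (power_prob mu m).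
Local Notation QQ := (Q \x Q)%E.
Local Notation T := (m.-tuple E).
Implicit Types (K L M : {set 'I_m}) (b g h : T -> R) (x y : T).

Definition depends_on K h :=
  forall x y, (forall i, i \in K -> tnth x i = tnth y i) -> h x = h y.

(** The variable [y] ranges over a full copy of E^m although only its coordinates off [K] are read;
    thus all [condE K] act on functions on one space and E^m is never split into E^K and its
    complement. *)
Definition condE K h x : R := \int[Q]_y h (splice K x y).

Lemma depends_on_condE K h : depends_on K (condE K h).
Proof.
move=> x y xy; apply: eq_Rintegral => z _; congr h.
by apply/eq_from_tnth => i; rewrite !tnth_splice; case: ifPn => // /xy.
Qed.

Lemma depends_onS K L h : K \subset L -> depends_on K h -> depends_on L h.
Proof. by move=> /fintype.subsetP KL hK x y xy; apply: hK => i /KL; exact: xy. Qed.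

Lemma depends_on_splice K h x y : depends_on K h -> h (splice K x y) = h x.
Proof. by apply => i iK; rewrite tnth_splice iK. Qed.

Lemma Rintegral_Q_cst r : \int[Q]__ r = r.
Proof.
rewrite Rintegral_cst// [X in fine X](_ : _ = 1%E) ?mulr1//.
exact: probability_setT.
Qed.

Lemma condE_id K h : depends_on K h -> condE K h = h.
Proof.
move=> hK; apply/funext => x; rewrite /condE.
under eq_Rintegral do rewrite depends_on_splice//.
exact: Rintegral_Q_cst.
Qed.

Lemma condEU1 K i h :
  depends_on [set~ i]%SET h -> condE (i |: K)%SET h = condE K h.
Proof.
move=> hi; apply/funext => x; apply: eq_Rintegral => y _; apply: hi => j.
by rewrite !inE !tnth_splice !inE => /negbTE ->.
Qed.

Lemma measurable_splice_comp K h : measurable_fun setT h ->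
  measurable_fun setT (fun z : T * T => h (splice K z.1 z.2)).
Proof.
move=> mh; have [ms _] := splice_measure_preserving mu K.
exact: (measurableT_comp mh ms).
Qed.

Lemma measurable_splicer K x : measurable_fun setT (splice K x).
Proof.
apply/measurable_fun_tnthP => i.
have [iK|iK] := boolP (i \in K).
  rewrite (_ : _ \o _ = cst (tnth x i)) //.
  by apply/funext => y /=; rewrite tnth_splice iK.
rewrite (_ : _ \o _ = (fun y => tnth y i)); first exact: measurable_tnth.
by apply/funext => y /=; rewrite tnth_splice (negbTE iK).
Qed.

Lemma measurable_splicel K y : measurable_fun setT (splice K ^~ y).
Proof.
rewrite (_ : (fun x => _) = splice (~: K)%SET y); first exact: measurable_splicer.
by apply/funext => x; apply/eq_from_tnth => i; rewrite !tnth_splice inE if_neg.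
Qed.

Lemma measurable_condE K h :
  measurable_fun setT h -> measurable_fun setT (condE K h).
Proof. by move=> mh; exact: (measurable_Rintegral Q (measurable_splice_comp K mh)). Qed.

(* Exactly what Fubini needs for E[b E[h | K]]. *)
Definition pairable K b h :=
  integrable_real QQ (fun z => b z.1 * h (splice K z.1 z.2)).

Lemma integrable_splice K h : integrable_real Q h ->
  integrable_real QQ (fun z => h (splice K z.1 z.2)).
Proof.
exact: (measure_preserving_integrable_real (splice_measure_preserving mu K)).
Qed.

Lemma pairable_bounded K b h C : measurable_fun setT b ->
  (forall x, `|b x| <= C) -> integrable_real Q h -> pairable K b h.
Proof.
move=> mb bC hi; apply: (@integrable_real_mul_bounded _ _ _ _
  (fun z : T * T => h (splice K z.1 z.2)) (fun z => b z.1) C) => //.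
  exact: (measurableT_comp mb measurable_fst).
exact: integrable_splice.
Qed.

Lemma pairable_Lfun2 K b h :
  b \in Lfun Q 2%:E -> h \in Lfun Q 2%:E -> pairable K b h.
Proof.
move=> b2 h2; apply/Lfun1_integrable.
apply: (@Lfun2_mul_Lfun1 _ _ _ _ (b \o fst)
  (fun z : T * T => h (splice K z.1 z.2))).
  exact: (measure_preserving_Lfun (fst_measure_preserving _ _) b2).
exact: (measure_preserving_Lfun (splice_measure_preserving mu K) h2).
Qed.

Lemma spliceK K x y : splice K (splice K x y) (splice K y x) = x.
Proof. by apply/eq_from_tnth => i; rewrite !tnth_splice; case: ifP => [->|->]. Qed.

Lemma pairable_sym K b h : pairable K b h -> pairable K h b.
Proof.
move=> /(measure_preserving_integrable_real
  (swap_off_measure_preserving mu K)).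
by congr integrable_real; apply/funext => z; rewrite /= spliceK mulrC.
Qed.

(** As [b] reads only coordinates in [K], the product in [pairable] is [b * h] evaluated at the
    spliced point, whose law is mu^m. *)
Lemma pairable_depends K b h : depends_on K b ->
  integrable_real Q (fun x => b x * h x) -> pairable K b h.
Proof.
move=> bK /(integrable_splice K); congr integrable_real.
by apply/funext => z; rewrite depends_on_splice.
Qed.

Lemma condE_pair K b h : measurable_fun setT h -> pairable K b h ->
  integrable_real Q (fun x => b x * condE K h x) /\
  \int[Q]_x (b x * condE K h x) =
  \int[QQ]_z (b z.1 * h (splice K z.1 z.2)).
Proof.
move=> mh /Rfubini[]/=.
have -> : (fun x => \int[Q]_y (b x * h (splice K x y))) =
          (fun x => b x * condE K h x).
  apply/funext => x; rewrite Rintegral_mull//.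
  exact: (measurableT_comp mh (measurable_splicer K x)).
by [].
Qed.

Lemma condE_adj K b h : measurable_fun setT b -> measurable_fun setT h ->
  pairable K b h ->
  \int[Q]_x (b x * condE K h x) = \int[Q]_x (condE K b x * h x).
Proof.
move=> mb mh bh; have [_ ->] := condE_pair mh bh.
rewrite (measure_preserving_Rintegral (swap_off_measure_preserving mu K)).
  have [_ hb] := condE_pair mb (pairable_sym bh).
  rewrite -[LHS](_ : \int[Q]_x (h x * condE K b x) = _).
    by apply: eq_Rintegral => x _; rewrite mulrC.
  by rewrite hb; apply: eq_Rintegral => z _; rewrite /= spliceK mulrC.
apply: measurable_funM; first exact: (measurableT_comp mb measurable_fst).
exact: measurable_splice_comp.
Qed.

(** The defining property of conditional expectation: move [condE K] onto [b], which it fixes. *)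
Lemma condE_pull K b h : depends_on K b ->
  measurable_fun setT b -> measurable_fun setT h ->
  integrable_real Q (fun x => b x * h x) ->
  \int[Q]_x (b x * condE K h x) = \int[Q]_x (b x * h x).
Proof.
by move=> bK mb mh bhi; rewrite condE_adj ?condE_id//; exact: pairable_depends.
Qed.

Lemma integrable_condE K h :
  integrable_real Q h -> integrable_real Q (condE K h).
Proof.
move=> hi; have p1 : pairable K (cst 1) h.
  by apply: (@pairable_bounded K (cst 1) h 1) => // x; rewrite normr1.
have [+ _] := condE_pair (integrable_real_measurable hi) p1.
by congr integrable_real; apply/funext => x; rewrite mul1r.
Qed.

Lemma condE_bounded K b (C : R) : measurable_fun setT b ->
  (forall x, `|b x| <= C) -> forall x, `|condE K b x| <= C.
Proof.
move=> mb bC x.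
have mbx : measurable_fun setT (fun y => b (splice K x y)).
  exact: (measurableT_comp mb (measurable_splicer K x)).
have ci r : integrable_real Q (cst r) by exact: finite_measure_integrable_cst.
have bi : integrable_real Q (fun y => b (splice K x y)).
  by apply: (integrable_real_le mbx _ (ci C)).
rewrite (le_trans (le_normr_Rintegral _ _))//.
have nbi : integrable_real Q (fun y => `|b (splice K x y)|).
  apply: (integrable_real_le _ _ (ci C)) => [|y]; last by rewrite normr_id.
  exact: measurableT_comp.
by rewrite -[leRHS]Rintegral_Q_cst; apply: (le_Rintegral _ nbi (ci C)).
Qed.

Lemma indic_le1 (B : set T) x : `|\1_B x : R| <= 1.
Proof. by rewrite indicE; case: (_ \in _); rewrite ?normr1 ?normr0. Qed.

(** Tested against an indicator, the outer operator moves to the test function. The result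
    [condE K \1_B] is bounded and, as K is included in M, depends on [M] only, so [condE M] can be
    removed from [h]. *)
Lemma condE_tower K M h : K \subset M -> integrable_real Q h ->
  {ae Q, forall x, condE K (condE M h) x = condE K h x}.
Proof.
move=> KM hi; have mh := integrable_real_measurable hi.
apply: ae_eq_of_Rintegral => [||B mB]; [exact/integrable_condE/integrable_condE|
  exact: integrable_condE|].
have mB1 : measurable_fun setT (\1_B : T -> R) by exact: measurable_indic.
have Mhi := integrable_condE M hi.
rewrite (condE_adj mB1 (integrable_real_measurable Mhi))//; last first.
  exact: (pairable_bounded _ mB1 (@indic_le1 B)).
rewrite (condE_adj mB1 mh)//; last first.
  exact: (pairable_bounded _ mB1 (@indic_le1 B)).
have mKB := measurable_condE K mB1.
apply: condE_pull => //; first exact/(depends_onS KM)/depends_on_condE.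
apply: (integrable_real_mul_bounded mKB _ hi).
exact: (condE_bounded _ mB1 (@indic_le1 B)).
Qed.

(* Exchange the i-th coordinates of the two copies of the sample: b does not
   see the exchange. *)
Lemma condE_setU1 K L i b h : measurable_fun setT b -> measurable_fun setT h ->
  (forall K', pairable K' b h) -> depends_on L b -> i \notin L -> i \notin K ->
  \int[Q]_x (b x * condE K h x) = \int[Q]_x (b x * condE (i |: K)%SET h x).
Proof.
move=> mb mh bh bL iL iK.
have [_ ->] := condE_pair mh (bh K); have [_ ->] := condE_pair mh (bh (i |: K)%SET).
have mp := swap_off_measure_preserving mu [set~ i]%SET.
rewrite (measure_preserving_Rintegral mp).
  apply: eq_Rintegral => z _ /=; congr (_ * h _).
    apply: bL => j jL; rewrite tnth_splice !inE.
    by case: eqP => // ji; rewrite -ji jL in iL.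
  apply/eq_from_tnth => j; rewrite !tnth_splice !inE.
  by have [->|] := eqVneq j i; rewrite ?(negbTE iK).
apply: measurable_funM; first exact: (measurableT_comp mb measurable_fst).
exact: measurable_splice_comp.
Qed.

(** The form in which degeneracy is applied: [a] is a kernel centered in coordinate [i], and [c] is
    the other kernel, which does not read [i]. *)
Lemma condE_null K i a c : i \notin K -> depends_on [set~ i]%SET c ->
  measurable_fun setT a -> measurable_fun setT c ->
  integrable_real Q (fun x => c x * a x) ->
  {ae Q, forall x, condE [set~ i]%SET a x = 0} ->
  {ae Q, forall x, condE K (fun x => c x * a x) x = 0}.
Proof.
move=> iK ci ma mc cai a0.
have mca : measurable_fun setT (fun x => c x * a x) by exact: measurable_funM.
have i0 : integrable_real Q (fun=> 0) by exact: finite_measure_integrable_cst.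
apply: ae_eq_of_Rintegral => //; first exact: integrable_condE.
move=> B mB.
have mB1 : measurable_fun setT (\1_B : T -> R) by exact: measurable_indic.
rewrite (condE_adj mB1 mca); last exact: (pairable_bounded _ mB1 (@indic_le1 B)).
have mKB := measurable_condE K mB1.
transitivity (\int[Q]_x (condE K \1_B x * c x * a x)).
  by apply: eq_Rintegral => x _; rewrite mulrA.
have KB i' : i' \notin K -> depends_on [set~ i']%SET (condE K \1_B).
  move=> iK'; apply: (depends_onS _ (@depends_on_condE K _)).
  by apply/fintype.subsetP => j jK; rewrite !inE; apply: contraNneq iK' => <-.
(* The factor [condE K \1_B * c] ignores coordinate [i], so [a] may be replaced by its conditional
   expectation given all the other coordinates, which vanishes. *)
rewrite -(@condE_pull [set~ i]%SET); first last.
- rewrite (_ : (fun x => _) = fun x => condE K \1_B x * (c x * a x)).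
    apply: (integrable_real_mul_bounded mKB _ cai).
    exact: (condE_bounded _ mB1 (@indic_le1 B)).
  by apply/funext => x; rewrite mulrA.
- by [].
- exact: measurable_funM.
- by move=> x y xy; congr (_ * _); [exact: (KB _ iK)|exact: ci].
apply: ae_eq_Rintegral.
- by apply: measurable_funM; [exact: measurable_funM|exact: measurable_condE].
- by apply: measurable_funM.
- by apply: filterS a0 => x ->; rewrite !mulr0.
Qed.

End ConditionalExpectation.

(** * Hoeffding projections *)

(** Sign-reversing involution: each [K] without [i] cancels against [i |: K]. *)
Lemma sum_toggle0 (V : zmodType) (I : finType) (i : I) (P : pred {set I})
    (F : {set I} -> V) :
  (forall K : {set I}, i \notin K -> P (i |: K)%SET = P K) ->
  (forall K : {set I}, i \notin K -> P K -> F (i |: K)%SET = - F K) ->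
  \sum_(K : {set I} | P K) F K = 0.
Proof.
move=> Pi Fi; rewrite (bigID (fun K : {set I} => i \in K))/=.
rewrite (reindex_onto (fun K : {set I} => i |: K)%SET (fun K => K :\ i)%SET).
  rewrite [X in X + _](eq_bigl (fun K : {set I} => P K && (i \notin K))); last first.
    move=> K; rewrite finset.setU11 andbT; have [iK|iK] := boolP (i \in K).
      rewrite andbF; apply/negbTE; rewrite negb_and orbC; apply/orP; left.
      by apply: contraTneq iK => <-; rewrite !inE eqxx.
    by rewrite Pi// finset.setU1K// eqxx.
  rewrite -big_split/= big1// => K /andP[PK iK].
  by rewrite Fi// addNr.
by move=> K /andP[_ iK]; rewrite finset.setD1K.
Qed.

Lemma alternating_sum0 (R : pzRingType) (I : finType) (M : {set I}) (i : I)
    (a : {set I} -> R) : i \in M ->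
  (forall K : {set I}, i \notin K -> K \subset M -> a (i |: K)%SET = a K) ->
  \sum_(K : {set I} | K \subset M) (-1) ^+ (#|M| - #|K|) * a K = 0.
Proof.
move=> iM ai; apply: (@sum_toggle0 _ _ i) => K iK.
  by rewrite finset.subUset finset.sub1set iM.
move=> KM; rewrite ai// cardsU1 iK -mulNr; congr (_ * _).
(* The subtraction is truncated: strictness ensures that adding [i] to [K] lowers the exponent by
   exactly one. *)
have KltM : (#|K| < #|M|)%N.
  by apply: proper_card; rewrite properE KM/=; apply/subsetPn; exists i.
by rewrite -(subnSK KltM) exprS mulN1r opprK add1n.
Qed.

(** This is the coefficient of [condE K h] in the sum of all projections of [h]. *)
Lemma alternating_sum_supsets (R : pzRingType) (I : finType) (K : {set I}) :
  \sum_(M : {set I} | K \subset M) (-1) ^+ (#|M| - #|K|) =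
  (K == [set: I]%SET)%:R :> R.
Proof.
have [->|] := eqVneq K [set: I]%SET.
  rewrite (eq_bigl (pred1 [set: I]%SET)) ?big_pred1_eq ?subnn// => M.
  by rewrite finset.subTset.
rewrite -finset.subTset => /subsetPn[i _ iK].
apply: (@sum_toggle0 _ _ i) => M iM.
  apply/idP/idP => [/fintype.subsetP KM|KM]; last first.
    exact: fintype.subset_trans KM (finset.subsetUr _ _).
  apply/fintype.subsetP => j jK; have := KM _ jK.
  by rewrite !inE => /predU1P[ji|//]; rewrite -ji jK in iK.
move=> KM; rewrite cardsU1 iM add1n subSn ?exprS ?mulN1r//.
exact: subset_leq_card.
Qed.

Section HoeffdingProjection.
Context d (E : measurableType d) (R : realType) (mu : probability E R).
Variable m : nat.
Local Notation Q := (power_prob mu m).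
Local Notation T := (m.-tuple E).
Local Notation condE := (condE mu).
Implicit Types (K L M : {set 'I_m}) (b g h : T -> R) (x y : T).

Definition hproj M h x : R :=
  \sum_(K : {set 'I_m} | K \subset M) (-1) ^+ (#|M| - #|K|) * condE K h x.

Lemma depends_on_hproj M h : depends_on M (hproj M h).
Proof.
move=> x y xy; apply: eq_bigr => K KM; congr (_ * _).
exact: (depends_onS KM (@depends_on_condE _ _ _ mu m K h)).
Qed.

Lemma integrable_hproj M h :
  integrable_real Q h -> integrable_real Q (hproj M h).
Proof.
move=> hi; apply: integrable_real_sum => K _.
exact/integrable_realZ/integrable_condE.
Qed.

(** Only the full set survives the exchange of sums, and conditioning on all coordinates is exactly
    the identity; hence the equality holds at every point. *)
Lemma hproj_sum h x : \sum_(M : {set 'I_m}) hproj M h x = h x.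
Proof.
rewrite /hproj (exchange_big_dep predT)//=.
under eq_bigr do rewrite -mulr_suml alternating_sum_supsets.
rewrite (bigD1 [set: 'I_m]%SET)//= eqxx mul1r big1 ?addr0; last first.
  by move=> K /negbTE ->; rewrite mul0r.
rewrite condE_id// => y z yz; congr h; apply/eq_from_tnth => i.
by apply: yz; rewrite inE.
Qed.

(** By the tower property for the finitely many subsets of [M]. It allows the contraction, which is
    [condE M] of the product of the kernels, to replace that product. *)
Lemma hproj_condE M h : integrable_real Q h ->
  {ae Q, forall x, hproj M (condE M h) x = hproj M h x}.
Proof.
move=> hi.
have : {ae Q, forall x, forall K, K \subset M ->
    condE K (condE M h) x = condE K h x}.
  apply: filter_forall => K; have [KM|KM] := boolP (K \subset M).
    by apply: filterS (condE_tower KM hi) => x ->.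
  exact: aeW.
by apply: filterS => x xE; apply: eq_bigr => K KM; rewrite xE.
Qed.

(** For [i] in M \ L, adding [i] to [K] does not change the integral of [b * condE K h], as [b] does
    not read [i], but flips its sign in the alternating sum. *)
Lemma hproj_orthogonal M L b h : ~~ (M \subset L) -> depends_on L b ->
  measurable_fun setT b -> measurable_fun setT h ->
  (forall K, pairable mu K b h) ->
  integrable_real Q (fun x => b x * hproj M h x) /\
  \int[Q]_x (b x * hproj M h x) = 0.
Proof.
move=> /subsetPn[i iM iL] bL mb mh bh.
have sE : (fun x => b x * hproj M h x) = fun x =>
    \sum_(K : {set 'I_m} | K \subset M)
      (-1) ^+ (#|M| - #|K|) * (b x * condE K h x).
  apply/funext => x; rewrite mulr_sumr; apply: eq_bigr => K _.
  by rewrite mulrCA.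
have Ki K : integrable_real Q
    (fun x => (-1) ^+ (#|M| - #|K|) * (b x * condE K h x)).
  by apply: integrable_realZ; have [] := condE_pair mh (bh K).
rewrite sE; split; first by apply: integrable_real_sum => K _.
rewrite Rintegral_sum//.
rewrite (eq_bigr (fun K => (-1) ^+ (#|M| - #|K|) *
    \int[Q]_x (b x * condE K h x))); last first.
  move=> K _; rewrite RintegralZl//.
  by have [] := condE_pair mh (bh K).
by apply: (alternating_sum0 iM) => K iK _; rewrite -(condE_setU1 mb mh bh bL).
Qed.

Lemma condE_eq0_hproj M h : integrable_real Q h ->
  (forall K, K \subset M -> {ae Q, forall x, condE K h x = 0}) ->
  {ae Q, forall x, hproj M h x = 0}.
Proof.
move=> hi h0.
have : {ae Q, forall x, forall K, K \subset M -> condE K h x = 0}.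
  apply: filter_forall => K; have [KM|KM] := boolP (K \subset M).
    by apply: filterS (h0 _ KM) => x ->.
  exact: aeW.
by apply: filterS => x xE; apply: big1 => K KM; rewrite xE ?mulr0.
Qed.

(** Conditioning also on a coordinate that [h] ignores changes nothing, so the terms of [K] and
    [i |: K] cancel. *)
Lemma hproj_depends0 M i h : i \in M -> depends_on [set~ i]%SET h ->
  hproj M h = cst 0.
Proof.
move=> iM hi; apply/funext => x; apply: (alternating_sum0 iM) => K iK _.
by rewrite condEU1.
Qed.

(** Jensen's inequality on each section; by Tonelli and invariance under splicing the resulting
    double integral is that of h^2. *)
Lemma condE_Lfun2 K h : h \in Lfun Q 2%:E -> condE K h \in Lfun Q 2%:E.
Proof.
move=> h2; have /andP[+ _] := h2; rewrite inE/= => mh.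
have mK := measurable_condE mu K mh.
apply/andP; split; rewrite inE//= /finite_norm unlock /Lnorm poweR_lty//.
rewrite (eq_integral (fun x => ((condE K h x) ^+ 2)%:E)); last first.
  by move=> x _; rewrite /= powR_mulrn// real_normK// num_real.
have mh2 : measurable_fun setT (fun z => ((h z) ^+ 2)%:E).
  by apply/measurable_EFinP; exact: measurable_funX.
apply: (@le_lt_trans _ _ (\int[Q]_x \int[Q]_y ((h (splice K x y)) ^+ 2)%:E)%E).
  apply: ge0_le_integral => //.
  - by move=> x _; rewrite lee_fin sqr_ge0.
  - by apply/measurable_EFinP; exact: measurable_funX.
  - apply: (@measurable_fun_fubini_tonelli_F _ _ _ _ _ Q
      (fun z => ((h (splice K z.1 z.2)) ^+ 2)%:E)%E) => //.
      apply/measurable_EFinP; apply: measurable_funX.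
      exact: measurable_splice_comp.
    by move=> z; rewrite lee_fin sqr_ge0.
  - move=> x _; apply: sqr_Rintegral_le.
    exact: (measurableT_comp mh (measurable_splicer K x)).
have /integrableP[_] := Lfun2_integrable_sqr h2.
rewrite (eq_integral (fun x => ((h x) ^+ 2)%:E)); last first.
  by move=> x _; rewrite /= ger0_norm// sqr_ge0.
rewrite (measure_preserving_ge0_integral (splice_measure_preserving mu K))//.
  rewrite (fubini_tonelli1 (fun z => ((h (splice K z.1 z.2)) ^+ 2)%:E)%E)//.
    apply/measurable_EFinP; apply: measurable_funX.
    exact: measurable_splice_comp.
  by move=> z; rewrite lee_fin sqr_ge0.
by move=> y; rewrite lee_fin sqr_ge0.
Qed.

Lemma hproj_Lfun2 M h : h \in Lfun Q 2%:E -> hproj M h \in Lfun Q 2%:E.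
Proof.
move=> h2; have [] := @Lfun2_sum _ _ _ Q _ (index_enum {set 'I_m})
  (fun K => K \subset M) (fun K x => (-1) ^+ (#|M| - #|K|) * condE K h x) => //.
by move=> K _; exact/Lfun2_scale/condE_Lfun2.
Qed.

(* The condE K h with K a proper subset of M, whose combination h - hproj M h is,
   are all orthogonal to hproj M h. *)
Lemma hproj_contraction M h : h \in Lfun Q 2%:E -> depends_on M h ->
  \int[Q]_x (hproj M h x ^+ 2) <= \int[Q]_x (h x ^+ 2).
Proof.
move=> h2 hM; have /andP[+ _] := h2; rewrite inE/= => mh.
pose r x := \sum_(K : {set 'I_m} | K \proper M)
              - (-1) ^+ (#|M| - #|K|) * condE K h x.
have rE x : h x = hproj M h x + r x.
  rewrite /hproj (bigD1 M)//= subnn mul1r condE_id// -addrA.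
  rewrite [X in X + r x](eq_bigl (fun K => K \proper M)) => [|K]; last first.
    by rewrite finset.properEneq andbC.
  by rewrite -big_split/= big1 ?addr0// => K _; rewrite mulNr subrr.
have r2 : r \in Lfun Q 2%:E.
  have [] := @Lfun2_sum _ _ _ Q _ (index_enum {set 'I_m})
    (fun K => K \proper M)
    (fun K x => - (-1) ^+ (#|M| - #|K|) * condE K h x) => //.
  by move=> K _; exact/Lfun2_scale/condE_Lfun2.
have H2 := hproj_Lfun2 M h2.
have H2i : integrable_real Q (fun x => hproj M h x ^+ 2).
  exact: Lfun2_integrable_sqr H2.
have r2i : integrable_real Q (fun x => r x ^+ 2).
  exact: Lfun2_integrable_sqr r2.
have or K : K \proper M -> integrable_real Q (fun x => condE K h x * hproj M h x) /\
    \int[Q]_x (condE K h x * hproj M h x) = 0.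
  move=> KM; apply: (hproj_orthogonal (L := K)) => //.
  - by rewrite properE in KM; case/andP: KM.
  - exact: depends_on_condE.
  - exact: measurable_condE.
  - by move=> K'; apply: pairable_Lfun2 => //; exact: condE_Lfun2.
have rHE : (fun x => r x * hproj M h x) = fun x =>
    \sum_(K : {set 'I_m} | K \proper M)
       - (-1) ^+ (#|M| - #|K|) * (condE K h x * hproj M h x).
  by apply/funext => x; rewrite mulr_suml; apply: eq_bigr => K _; rewrite mulrA.
have rHi : integrable_real Q (fun x => r x * hproj M h x).
  rewrite rHE; apply: integrable_real_sum => K KM.
  by apply: integrable_realZ; case: (or K KM).
have rH : \int[Q]_x (r x * hproj M h x) = 0.
  rewrite rHE Rintegral_sum => [|K KM].
    apply: big1 => K KM; have [oi o0] := or K KM.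
    by rewrite RintegralZl// o0 mulr0.
  by apply: integrable_realZ; case: (or K KM).
rewrite [leRHS](_ : _ = \int[Q]_x (hproj M h x ^+ 2 +
    (r x ^+ 2 + 2 * (r x * hproj M h x)))); last first.
  by apply: eq_Rintegral => x _; rewrite rE sqrrD mulr2n mulr_natl; ring.
have rHi2 := integrable_realZ 2 rHi.
rewrite RintegralD//; last exact: integrable_realD.
rewrite RintegralD// RintegralZl// rH mulr0 addr0 lerDl.
by apply: Rintegral_ge0 => x _; exact: sqr_ge0.
Qed.

End HoeffdingProjection.

(** * Kernels evaluated on subsamples *)

Section SequenceMeasurability.
Context d' (T : measurableType d') d (E : measurableType d).

(** Kernel arguments are assembled with [++], [take] and [drop]; measurability is therefore tracked
    entry by entry on sequences of constant length and recovered for tuples by [measurable_pt]. *)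
Definition measurable_seq (f : T -> seq E) (n : nat) :=
  (forall w, size (f w) = n) /\
  forall i, measurable_fun setT (fun w => nth point (f w) i).

Lemma measurable_seq_tuple n (f : T -> n.-tuple E) :
  measurable_fun setT f -> measurable_seq f n.
Proof.
move=> mf; split=> [w|i]; first by rewrite size_tuple.
have [im|im] := ltnP i n.
  rewrite (_ : (fun w => _) = (fun w => tnth (f w) (Ordinal im))).
    exact: (measurableT_comp (measurable_tnth (Ordinal im)) mf).
  by apply/funext => w; rewrite (tnth_nth point).
rewrite (_ : (fun w => _) = cst point) //.
by apply/funext => w; rewrite nth_default// size_tuple.
Qed.

Lemma measurable_seq_cat f g n n' : measurable_seq f n -> measurable_seq g n' ->
  measurable_seq (fun w => f w ++ g w) (n + n').
Proof.
move=> [fn mf] [gn mg]; split=> [w|i]; first by rewrite size_cat fn gn.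
under eq_fun do rewrite nth_cat fn.
by case: (i < n)%N; [exact: mf|exact: mg].
Qed.

Lemma measurable_seq_take f n k :
  measurable_seq f n -> measurable_seq (fun w => take k (f w)) (minn k n).
Proof.
move=> [fn mf]; split=> [w|i]; first by rewrite size_take_min fn.
have [ik|ik] := ltnP i k.
  under eq_fun do rewrite nth_take//.
  exact: mf.
rewrite (_ : (fun w => _) = cst point) //.
by apply/funext => w; rewrite nth_default// size_take_min geq_min ik.
Qed.

Lemma measurable_seq_drop f n k :
  measurable_seq f n -> measurable_seq (fun w => drop k (f w)) (n - k).
Proof.
move=> [fn mf]; split=> [w|i]; first by rewrite size_drop fn.
under eq_fun do rewrite nth_drop.
exact: mf.
Qed.

Lemma measurable_seq_cst s : measurable_seq (fun=> s) (size s).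
Proof.
by split=> // i; exact: (@measurable_cst _ _ T E setT (nth point s i)).
Qed.

Lemma measurable_pt f n k :
  measurable_seq f n -> measurable_fun setT (fun w => pt k (f w)).
Proof.
move=> [_ mf]; apply/measurable_fun_tnthP => i.
rewrite (_ : _ \o _ = (fun w => nth point (f w) i)) //.
by apply/funext => w /=; rewrite tnth_mktuple.
Qed.

End SequenceMeasurability.

Section KernelsOnSamples.
Context d (E : measurableType d) (R : realType) (mu : probability E R).
Variable m : nat.
Local Notation Q := (power_prob mu).

Definition subsample (x : m.-tuple E) (s : seq 'I_m) := [seq tnth x i | i <- s].

Lemma pt_subsample k (s : k.-tuple 'I_m) x :
  pt k (subsample x s) = coords (tnth s) x.
Proof.
apply/eq_from_tnth => i; rewrite tnth_coords tnth_mktuple.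
rewrite (nth_map (tnth s i)) ?size_tuple//.
by rewrite -tnth_nth.
Qed.

Lemma coords_tnth k (s : k.-tuple 'I_m) x :
  coords (tnth s) x = subsample x s :> seq E.
Proof.
rewrite -[RHS]/(val [tuple of map (tnth x) s]); congr val.
by apply/eq_from_tnth => i; rewrite tnth_coords tnth_map.
Qed.

Definition kernel_at k (f : k.-tuple E -> R) (I : {set 'I_m}) x : R :=
  f (pt k (subsample x (enum I))).

(** Lets the arguments of a contraction, listed block by block, be read as the increasing
    enumeration of the union of the blocks. *)
Lemma symmetric_kernel_at k (f : k.-tuple E -> R) (I : {set 'I_m}) s x :
  symmetric_kernel f -> size s = k -> perm_eq s (enum I) ->
  f (pt k (subsample x s)) = kernel_at f I x.
Proof.
move=> fS /eqP sk sI; pose t := Tuple sk.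
have eI : size (enum I) == k by rewrite -(perm_size sI).
pose u := Tuple eI.
have /tuple_permP[g tg] : perm_eq t u by [].
rewrite /kernel_at -[s]/(val t) -[enum I]/(val u) !pt_subsample.
rewrite -[RHS](fS g); congr f; apply/eq_from_tnth => i.
by rewrite tnth_coords tnth_mktuple tnth_coords (val_inj tg) tnth_mktuple.
Qed.

Lemma kernel_at_coords k (f : k.-tuple E -> R) (I : {set 'I_m}) :
  #|I| = k -> exists2 s : 'I_k -> 'I_m, injective s &
     kernel_at f I = fun x => f (coords s x).
Proof.
move=> Ik; have eI : size (enum I) == k by rewrite -cardE Ik.
pose u := Tuple eI; exists (tnth u).
  by apply/tuple_uniqP; rewrite enum_uniq.
apply/funext => x.
by rewrite /kernel_at -[enum I]/(val u) pt_subsample.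
Qed.

Lemma depends_on_kernel_at k (f : k.-tuple E -> R) (I : {set 'I_m}) :
  depends_on I (kernel_at f I).
Proof.
move=> x y xy; rewrite /kernel_at; congr (f (pt k _)).
by apply/eq_in_map => i; rewrite mem_enum; exact: xy.
Qed.

Lemma kernel_at_Lfun2 k (f : k.-tuple E -> R) (I : {set 'I_m}) : #|I| = k ->
  f \in Lfun (Q k) 2%:E -> kernel_at f I \in Lfun (Q m) 2%:E.
Proof.
move=> Ik f2; have [s sI ->] := kernel_at_coords f Ik.
exact: (measure_preserving_Lfun (coords_measure_preserving mu sI) f2).
Qed.

Lemma tnth_measure_preserving (i : 'I_m) :
  measure_preserving (Q m) mu (fun y => tnth y i).
Proof.
split=> [|A mA]; first exact: measurable_tnth.
pose B j := if j == i then A else setT.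
have mB j : measurable (B j) by rewrite /B; case: eqP.
rewrite (_ : _ @^-1` _ = [set y | forall j, B j (tnth y j)]); last first.
  apply/seteqP; split => y /= Ay.
    by move=> j; rewrite /B; case: eqP => [->|].
  by have := Ay i; rewrite /B eqxx.
transitivity (\prod_(j < m) mu (B j))%E; first exact: (power_prob_box mu mB).
rewrite (bigD1 i)//= big1 ?mule1 ?/B ?eqxx// => j /negbTE ->.
exact: probability_setT.
Qed.

(** Degeneracy integrates the first argument; symmetry moves [i] there. The remaining coordinates
    have law mu^(k-1), so the exceptional null set pulls back to a null set of E^m. *)
Lemma degenerate_condE k (f : k.-tuple E -> R) (I : {set 'I_m}) i :
  measurable_fun setT f -> symmetric_kernel f -> degenerate mu f ->
  #|I| = k -> i \in I ->
  {ae Q m, forall x, condE mu [set~ i]%SET (kernel_at f I) x = 0}.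
Proof.
move=> mf fS fD Ik iI.
have sD : size (enum (I :\ i)%SET) == k.-1.
  by rewrite -cardE -Ik (cardsD1 i I) iI.
pose u := Tuple sD.
have uI : injective (tnth u).
  by apply/tuple_uniqP; rewrite enum_uniq.
have := measure_preserving_ae (coords_measure_preserving mu uI) fD.
apply: filterS => x x0.
rewrite /condE (_ : (fun y => _) =
    fun y => f (pt k (tnth y i :: coords (tnth u) x))).
  have mfx : measurable_fun setT
      (fun e : E => f (pt k (e :: coords (tnth u) x))).
    apply: (measurableT_comp mf); apply: (@measurable_pt _ _ _ _ _ k.-1.+1).
    split=> [w|j]; first by rewrite /= size_map size_enum_ord.
    case: j => [|j] /=; first exact: measurable_id.
    exact: (@measurable_cst _ _ E E setT (nth point _ j)).
  rewrite -(measure_preserving_Rintegral (tnth_measure_preserving i) mfx).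
  by rewrite /Rintegral x0.
apply/funext => y; rewrite -(symmetric_kernel_at (s := i :: enum (I :\ i)%SET))//.
- rewrite -[enum (I :\ i)%SET]/(val u) coords_tnth /subsample/=.
  congr (f (pt k (_ :: _))); first by rewrite tnth_splice !inE eqxx.
  by apply/eq_in_map => j; rewrite mem_enum tnth_splice !inE => /andP[-> _].
- by rewrite /= (eqP sD) -Ik; apply: prednK; apply/card_gt0P; exists i.
- apply: uniq_perm => [||j]; rewrite ?enum_uniq//=.
    by rewrite mem_enum !inE eqxx enum_uniq.
  by rewrite !(inE, mem_enum); have [->|] := eqVneq j i; rewrite ?iI.
Qed.

End KernelsOnSamples.

(** * Canonical components and contractions as operations on E^m *)

Section TopComponents.
Context d (E : measurableType d) (R : realType) (mu : probability E R).
Local Notation Q := (power_prob mu).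

Lemma measurable_kernel_contraction p q (psi : p.-tuple E -> R)
    (phi : q.-tuple E -> R) r l k :
  measurable_fun setT psi -> measurable_fun setT phi ->
  measurable_fun setT (kernel_contraction mu psi phi r l k).
Proof.
move=> mpsi mphi.
pose y (w : k.-tuple E * l.-tuple E) := take (r - l) w.1.
pose t (w : k.-tuple E * l.-tuple E) := take (p - r) (drop (r - l) w.1).
pose s (w : k.-tuple E * l.-tuple E) := drop (p - r) (drop (r - l) w.1).
have m1 : measurable_seq (fun w : k.-tuple E * l.-tuple E => w.1 : seq E) k.
  by apply: (@measurable_seq_tuple _ _ _ _ k fst); exact: measurable_fst.
have m2 : measurable_seq (fun w : k.-tuple E * l.-tuple E => w.2 : seq E) l.
  by apply: (@measurable_seq_tuple _ _ _ _ l snd); exact: measurable_snd.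
have my := measurable_seq_take (r - l) m1.
have mt := measurable_seq_take (p - r) (measurable_seq_drop (r - l) m1).
have ms := measurable_seq_drop (p - r) (measurable_seq_drop (r - l) m1).
apply: (@measurable_Rintegral _ _ _ _ R (Q l) (fun w =>
  psi (pt p (w.2 ++ y w ++ t w)) * phi (pt q (w.2 ++ y w ++ s w)))).
apply: measurable_funM.
  apply: (measurableT_comp mpsi); apply: measurable_pt.
  exact: (measurable_seq_cat m2 (measurable_seq_cat my mt)).
apply: (measurableT_comp mphi); apply: measurable_pt.
exact: (measurable_seq_cat m2 (measurable_seq_cat my ms)).
Qed.

Lemma measurable_fill k (K : {set 'I_k}) (z : k.-tuple E) l :
  measurable_fun setT (fun w : l.-tuple E => fill K z w).
Proof.
apply/measurable_fun_tnthP => i.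
have [_ mn] := measurable_seq_tuple (@measurable_id _ (l.-tuple E) setT).
have [iK|iK] := boolP (i \in K).
  rewrite (_ : _ \o _ = cst (tnth z i)) //.
  by apply/funext => w /=; rewrite tnth_mktuple iK.
rewrite (_ : _ \o _ = (fun w : l.-tuple E =>
  nth point w (index i (enum (~: K)%SET)))); first exact: mn.
by apply/funext => w /=; rewrite tnth_mktuple (negbTE iK).
Qed.

Variable m : nat.

(** The integration variables may be taken to be the coordinates of the second copy at the indices
    that [s] assigns to the positions outside [K]: these indices are distinct, so the law is the
    right power of mu. *)
Lemma fill_Rintegral k (f : k.-tuple E -> R) (s : k.-tuple 'I_m)
    (K : {set 'I_k}) (x : m.-tuple E) : measurable_fun setT f -> uniq s ->
  \int[Q (k - #|K|)]_w f (fill K (coords (tnth s) x) w) =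
  condE mu (tnth s @: K)%SET (fun y => f (coords (tnth s) y)) x.
Proof.
move=> mf us.
have sI : injective (tnth s) by exact/tuple_uniqP.
have eK : size (enum (~: K)%SET) == (k - #|K|)%N.
  by rewrite -cardE cardsCs finset.setCK card_ord.
pose u := Tuple eK.
have tI : injective (tnth s \o tnth u).
  by apply: inj_comp => //; apply/tuple_uniqP; rewrite enum_uniq.
have mfz : measurable_fun setT
    (fun w : (k - #|K|).-tuple E => f (fill K (coords (tnth s) x) w)).
  by apply: (measurableT_comp mf); exact: measurable_fill.
rewrite (measure_preserving_Rintegral (coords_measure_preserving mu tI) mfz).
apply: eq_Rintegral => y _; congr f; apply/eq_from_tnth => i.
rewrite tnth_mktuple !tnth_coords tnth_splice mem_imset//.
case: ifPn => // iK.
have iu : i \in enum (~: K)%SET by rewrite mem_enum inE.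
have ju : (index i (enum (~: K)%SET) < k - #|K|)%N.
  by rewrite -(eqP eK) index_mem.
rewrite -[index _ _]/(val (Ordinal ju)) -tnth_nth tnth_coords/=.
by rewrite (tnth_nth i) /= nth_index.
Qed.

(** As [s] enumerates [M], sets of positions correspond to subsets of [M] by taking images under
    [s], with equal cardinalities and hence equal signs. *)
Lemma top_component_hproj k (f : k.-tuple E -> R) (s : k.-tuple 'I_m)
    (M : {set 'I_m}) (x : m.-tuple E) : measurable_fun setT f -> uniq s ->
  M =i s ->
  top_component mu f (coords (tnth s) x) =
  hproj mu M (fun y => f (coords (tnth s) y)) x.
Proof.
move=> mf us Ms.
have sI : injective (tnth s) by exact/tuple_uniqP.
have Mk : #|M| = k by rewrite (eq_card Ms) (card_uniqP us) size_tuple.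
have MsE i : i \in M -> exists j, i = tnth s j.
  by rewrite Ms => /tnthP.
rewrite /hproj (reindex_onto (fun K : {set 'I_k} => tnth s @: K)%SET
    (fun K' => tnth s @^-1: K')%SET); last first.
  move=> K' K'M; apply/setP => i; apply/imsetP/idP => [[j]|iK'].
    by rewrite inE => sj ->.
  have [j ij] := MsE _ (fintype.subsetP K'M _ iK').
  by exists j => //; rewrite inE -ij.
rewrite /top_component; apply: eq_big => [K|K _].
  apply/esym/andP; split.
    by apply/fintype.subsetP => _ /imsetP[j _ ->]; rewrite Ms mem_tnth.
  by apply/eqP/setP => j; rewrite inE mem_imset.
by rewrite card_imset// Mk fill_Rintegral.
Qed.

Lemma uniq_enum_cat (A : {set 'I_m}) (s : seq 'I_m) :
  uniq s -> [disjoint A & s]%B -> uniq (enum A ++ s).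
Proof.
move=> us As; rewrite cat_uniq enum_uniq us andbT/=; apply/hasPn => i si.
by rewrite /= mem_enum; move: As; rewrite disjoint_sym => /disjointFr ->.
Qed.

Lemma disjoint_enum_cat (A B : {set 'I_m}) (s : seq 'I_m) :
  [disjoint A & B]%B -> [disjoint A & s]%B -> [disjoint A & enum B ++ s]%B.
Proof.
rewrite ![[disjoint A & _]%B]disjoint_sym !disjoint_subset.
move=> /fintype.subsetP AB /fintype.subsetP As; apply/fintype.subsetP => i.
by rewrite mem_cat mem_enum => /orP[/AB|/As].
Qed.

Lemma disjoint_nil (A : {set 'I_m}) : [disjoint A & [::] : seq 'I_m]%B.
Proof. by rewrite disjoint_sym disjoint_subset; apply/fintype.subsetP. Qed.

(** The variables integrated in the contraction become the coordinates in [D]. Being disjoint from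
    [M], these are read from the second copy by [splice M], whereas those in [A], [B] and [C] are
    read from [x]. *)
Lemma kernel_contraction_condE p q (psi : p.-tuple E -> R)
    (phi : q.-tuple E -> R) r l k (D A B C M : {set 'I_m}) (x : m.-tuple E) :
  measurable_fun setT psi -> measurable_fun setT phi ->
  symmetric_kernel psi -> symmetric_kernel phi ->
  (l <= r)%N -> (r <= p)%N -> (r <= q)%N ->
  #|D| = l -> #|A| = (r - l)%N -> #|B| = (p - r)%N -> #|C| = (q - r)%N ->
  (A :|: B :|: C = M)%SET ->
  [disjoint A & B]%B -> [disjoint A & C]%B -> [disjoint D & M]%B ->
  (k = r - l + (p - r) + (q - r))%N ->
  kernel_contraction mu psi phi r l k
    (pt k (subsample x (enum A ++ enum B ++ enum C))) =
  condE mu M (fun y => kernel_at psi (D :|: A :|: B)%SET y *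
                       kernel_at phi (D :|: A :|: C)%SET y) x.
Proof.
move=> mpsi mphi psiS phiS lr rp rq Dl Ar Bp Cq ABC AB AC DM kE.
pose s0 := enum A ++ enum B ++ enum C.
have sz : size s0 == k by rewrite !size_cat -!cardE Ar Bp Cq addnA kE.
pose s := Tuple sz.
have ptE : pt k (subsample x s0) = subsample x s0 :> seq E.
  by rewrite -[s0]/(val s) pt_subsample coords_tnth.
have disjD (F : {set 'I_m}) : F \subset M -> [disjoint D & F]%B.
  by move=> FM; rewrite disjoint_sym; apply: disjointWl FM _; rewrite disjoint_sym.
have AM : A \subset M by rewrite -ABC -finset.setUA finset.subsetUl.
have BM : B \subset M.
  by rewrite -ABC; apply/fintype.subsetP => i iB; rewrite !inE iB orbT.
have CM : C \subset M by rewrite -ABC finset.subsetUr.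
have eD : size (enum D) == l by rewrite -cardE Dl.
pose u := Tuple eD.
have uI : injective (tnth u).
  by apply/tuple_uniqP; rewrite enum_uniq.
have spl y (F : {set 'I_m}) : F \subset M ->
    subsample x (enum F) = subsample (splice M x y) (enum F).
  move=> /fintype.subsetP FM; apply/eq_in_map => i; rewrite mem_enum => /FM iM.
  by rewrite tnth_splice iM.
have splD y : coords (tnth u) y = subsample (splice M x y) (enum D) :> seq E.
  rewrite coords_tnth; apply/eq_in_map => i; rewrite mem_enum => iD.
  by rewrite tnth_splice (disjointFr DM).
have perm (F : {set 'I_m}) : F \subset M -> [disjoint A & F]%B ->
    perm_eq (enum D ++ enum A ++ enum F) (enum (D :|: A :|: F)%SET).
  move=> FM AF; apply: uniq_perm; rewrite ?enum_uniq//.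
    rewrite uniq_enum_cat ?uniq_enum_cat ?enum_uniq//.
      by rewrite -[enum F]cats0; apply: disjoint_enum_cat AF (disjoint_nil _).
    apply: disjoint_enum_cat; first exact: disjD.
    rewrite -[enum F]cats0; apply: disjoint_enum_cat (disjoint_nil _).
    exact: disjD.
  by move=> i; rewrite !(mem_cat, mem_enum, inE) orbA.
have tA : take (r - l) (subsample x s0) = subsample x (enum A).
  by rewrite /subsample map_cat take_size_cat// size_map -cardE.
have dA : drop (r - l) (subsample x s0) =
    subsample x (enum B) ++ subsample x (enum C).
  by rewrite /subsample !map_cat drop_size_cat// size_map -cardE.
have tB : take (p - r) (drop (r - l) (subsample x s0)) = subsample x (enum B).
  by rewrite dA take_size_cat// size_map -cardE.
have dB : drop (p - r) (drop (r - l) (subsample x s0)) = subsample x (enum C).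
  by rewrite dA drop_size_cat// size_map -cardE.
rewrite /kernel_contraction ptE tA tB dB.
have mseq (F : seq E) : measurable_seq
    (fun w : l.-tuple E => w ++ subsample x (enum A) ++ F)
    (l + (size (subsample x (enum A)) + size F)).
  apply: measurable_seq_cat.
    exact: (@measurable_seq_tuple _ _ _ _ l id (@measurable_id _ _ _)).
  apply: measurable_seq_cat; exact: measurable_seq_cst.
have mf : measurable_fun setT (fun w : l.-tuple E =>
    psi (pt p (w ++ subsample x (enum A) ++ subsample x (enum B))) *
    phi (pt q (w ++ subsample x (enum A) ++ subsample x (enum C)))).
  apply: measurable_funM.
    by apply: (measurableT_comp mpsi); apply: measurable_pt (mseq _).
  by apply: (measurableT_comp mphi); apply: measurable_pt (mseq _).
rewrite (measure_preserving_Rintegral (coords_measure_preserving mu uI) mf).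
apply: eq_Rintegral => y _; rewrite splD !(spl y)//.
rewrite /subsample -!map_cat -!/(subsample _ _).
rewrite (symmetric_kernel_at _ psiS _ (perm _ BM AB)).
  rewrite (symmetric_kernel_at _ phiS _ (perm _ CM AC))//.
  rewrite !size_cat -!cardE Dl Ar Cq; lia.
rewrite !size_cat -!cardE Dl Ar Bp; lia.
Qed.

End TopComponents.

(** * Index sets *)

Section IndexSets.
Variables (m n : nat) (nm : (n <= m)%N).

Lemma initial_segE :
  initial_seg m n = (@widen_ord n m nm @: [set: 'I_n])%SET.
Proof.
apply/setP => i; rewrite inE; apply/idP/imsetP => [im|[j _ ->]]; last exact: (ltn_ord j).
by exists (Ordinal im) => //; apply/val_inj.
Qed.

Lemma widen_ord_inj : injective (@widen_ord n m nm).
Proof. by move=> i j [] /val_inj. Qed.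

Lemma card_initial_seg : #|initial_seg m n| = n.
Proof. by rewrite initial_segE card_imset ?cardsT ?card_ord//; exact: widen_ord_inj. Qed.

Lemma final_segE : final_seg m n = (~: initial_seg m n)%SET.
Proof. by apply/setP => i; rewrite !inE -leqNgt. Qed.

Lemma card_final_seg : #|final_seg m n| = (m - n)%N.
Proof. by rewrite final_segE cardsCs finset.setCK card_initial_seg card_ord. Qed.

Lemma card_initial_part (M : {set 'I_m}) :
  #|M :&: initial_seg m n| = (#|M| - #|M :&: final_seg m n|)%N.
Proof.
by rewrite -(cardsID (initial_seg m n) M) final_segE -finset.setDE addnK.
Qed.

End IndexSets.

(** * Statistics as sums over index sets, and arithmetic of the indices *)

Section JstatSum.
Context (R : realType) dO (Omega : measurableType dO) (P : probability Omega R).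
Context d (E : measurableType d) (X : nat -> {RV P >-> E}) (m : nat).

Definition sample_tuple (w : Omega) : m.-tuple E := [tuple X i w | i < m].

Lemma sample_subsample (A : {set 'I_m}) w :
  sample X A w = subsample (sample_tuple w) (enum A).
Proof. by apply: eq_map => i; rewrite tnth_mktuple. Qed.

(** An increasing tuple is determined by its set of entries. Embedding [n] into [m] puts both
    statistics on the same sample of size m. *)
Lemma Jstat_sets n p (psi : p.-tuple E -> R) w : (n <= m)%N ->
  symmetric_kernel psi ->
  Jstat X n psi w =
  \sum_(I : {set 'I_m} | (I \subset initial_seg m n) && (#|I| == p))
     kernel_at psi I (sample_tuple w).
Proof.
move=> nm psiS; set wi := widen_ord nm.
have wiI : injective wi := @widen_ord_inj _ _ nm.
pose lt (a b : 'I_n) := (a < b)%N.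
have ltT : ssrbool.transitive lt by move=> a b c; exact: ltn_trans.
have ltI : ssrbool.irreflexive lt by move=> a; rewrite /lt ltnn.
pose f (i : p.-tuple 'I_n) : {set 'I_m} := [set wi j | j in i]%SET.
pose S := [set i : p.-tuple 'I_n | sorted lt i]%SET.
have fI : {in S &, injective f}.
  move=> i j; rewrite !inE => si sj fij.
  apply/val_inj; apply: (irr_sorted_eq ltT ltI si sj) => a.
  have := congr1 (fun A : {set 'I_m} => wi a \in A) fij.
  by rewrite /f !mem_imset.
have fS : [set I : {set 'I_m} | (I \subset initial_seg m n) && (#|I| == p)]%SET
        = (f @: S)%SET.
  apply/setP => I; rewrite inE; apply/andP/imsetP => [[In /eqP Ip]|[i]].
    pose J := (wi @^-1: I)%SET.
    have IJ : I = (wi @: J)%SET.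
      apply/setP => a; apply/idP/imsetP => [aI|[b]].
        have := fintype.subsetP In _ aI.
        rewrite (initial_segE nm) => /imsetP[b _ ab].
        by exists b => //; rewrite inE; move: aI; rewrite ab.
      by rewrite inE => bI ->.
    have Jp : size (enum J) == p by rewrite -cardE -(card_imset _ wiI) -IJ Ip.
    exists (Tuple Jp).
      rewrite inE /=; apply: sorted_filter; first exact: ltT.
      rewrite -(@sorted_map _ _ val (fun a b => a < b)%N).
      by rewrite -enumT val_enum_ord; exact: iota_ltn_sorted.
    rewrite [LHS]IJ; apply/setP => a.
    by apply/imsetP/imsetP => -[b bJ ->]; exists b; rewrite // mem_enum in bJ *.
  rewrite inE => si ->; split.
    by apply/fintype.subsetP => _ /imsetP[b _ ->]; rewrite inE; exact: (ltn_ord b).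
  rewrite card_imset// (card_uniqP _) ?size_tuple//.
  exact: (sorted_uniq ltT ltI si).
rewrite [RHS](eq_bigl (fun I => I \in f @: S)%SET); last first.
  by move=> I; rewrite -fS inE.
rewrite big_imset//=; apply: eq_big => [i|i si]; first by rewrite inE.
 rewrite -(symmetric_kernel_at (s := map wi i))//.
- congr psi; apply/eq_from_tnth => j; rewrite !tnth_mktuple /subsample -map_comp.
  by rewrite (nth_map (tnth i j)) ?size_tuple//= tnth_mktuple -tnth_nth.
- by rewrite size_map size_tuple.
- apply: uniq_perm; rewrite ?enum_uniq//.
    by rewrite map_inj_uniq//; exact: (sorted_uniq ltT ltI si).
  move=> a; rewrite mem_enum; apply/mapP/imsetP => -[b bi ->]; by exists b.
Qed.

End JstatSum.

(** The sizes of [D] and [A] add up to r: the lower bound on r, the ceiling of (p + q - k) / 2,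
    prevents truncation in 2r + k - p - q. *)
Lemma contraction_indexK p q r k :
  (k <= p + q)%N -> (uphalf (p + q - k) <= r)%N ->
  (r <= p + q - k)%N -> (p + q - r - k + (2 * r + k - p - q) = r)%N.
Proof. by rewrite leq_uphalf_double -muln2; lia. Qed.

(** Here r, x, y are the sizes of the intersection of I and J, of I \ J and of J \ I; a and a' count
    the common indices inside and outside M, and t is m - n. *)
Lemma component_pair_arith p q k s t r a a' x y :
  (r + x = p)%N -> (r + y = q)%N -> (a + a' = r)%N -> (k = a + x + y)%N ->
  (s <= y)%N -> (s <= k)%N -> (s <= t)%N ->
  [/\ (k <= p + q)%N, (s <= minn q (minn k t))%N, (uphalf (p + q - k) <= r)%N,
      (r <= minn p (minn (q - s) (p + q - k)))%N & a' = (p + q - r - k)%N].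
Proof. rewrite !leq_min leq_uphalf_double -muln2 => *; split; lia. Qed.

Lemma pair_triple_arith p q k r a a' x y :
  (r + x = p)%N -> (r + y = q)%N -> (a + a' = r)%N -> (k = a + x + y)%N ->
  [/\ a = (2 * r + k - p - q)%N, x = (p - r)%N & y = (q - r)%N].
Proof. by move=> *; split; lia. Qed.

Lemma triples_arith p q k s r : (s <= k)%N -> (k <= p + q)%N ->
  (uphalf (p + q - k) <= r)%N -> (r <= minn p (minn (q - s) (p + q - k)))%N ->
  (s <= q)%N -> (k - s = 2 * r + k - p - q + (p - r) + (q - r - s))%N.
Proof. by rewrite !leq_min leq_uphalf_double -muln2; lia. Qed.

Lemma contraction_index_size p q k r a a' x y :
  (r + x = p)%N -> (r + y = q)%N -> (a + a' = r)%N -> (k = a + x + y)%N ->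
  k = (r - a' + (p - r) + (q - r))%N.
Proof. by lia. Qed.

Lemma subnBA_le n k s : (s <= k)%N -> (k <= n)%N ->
  (n - (k - s) = n - k + s)%N.
Proof. by lia. Qed.

(** * Pairs of index sets contributing to a component *)

Section ProductComponents.
Context (R : realType) dO (Omega : measurableType dO) (P : probability Omega R).
Context d (E : measurableType d) (mu : probability E R).
Context (X : nat -> {RV P >-> E}) (m n p q : nat).
Context (psi : p.-tuple E -> R) (phi : q.-tuple E -> R).
Local Notation pairs := ({set 'I_m} * {set 'I_m})%type.

Implicit Types (IJ : pairs) (M : {set 'I_m}).

Definition kernel_product (IJ : pairs) (x : m.-tuple E) : R :=
  kernel_at psi IJ.1 x * kernel_at phi IJ.2 x.

Definition base_pair (IJ : pairs) :=
  [&& IJ.1 \subset initial_seg m n, #|IJ.1| == p & #|IJ.2| == q].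

(* By degeneracy, psi(X_I) phi(X_J) has no component at the other sets M. *)
Definition component_pair (M : {set 'I_m}) (IJ : pairs) :=
  [&& base_pair IJ, IJ.1 :\: IJ.2 \subset M, IJ.2 :\: IJ.1 \subset M &
      M \subset IJ.1 :|: IJ.2]%SET.

Definition pair_triple (M : {set 'I_m}) (IJ : pairs) :=
  (IJ.1 :&: IJ.2 :&: M, IJ.1 :\: IJ.2, IJ.2 :\: IJ.1)%SET.

Lemma triplesP r (M A B C : {set 'I_m}) :
  (A, B, C) \in triples p q r n M ->
  [/\ A \subset initial_seg m n, B \subset initial_seg m n,
      #|A| = (2 * r + #|M| - p - q)%N, #|B| = (p - r)%N & #|C| = (q - r)%N] /\
  [/\ [disjoint A & B]%B, [disjoint A & C]%B, [disjoint B & C]%B &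
      (A :|: B :|: C = M)%SET].
Proof.
rewrite inE /= /ksubsets !inE => /and5P[/andP[An /eqP Ac] /andP[Bn /eqP Bc]].
by move=> /andP[_ /eqP Cc] AB /and3P[AC BC /eqP ABC].
Qed.

Lemma triple_tuple r M A B C : (A, B, C) \in triples p q r n M ->
  exists s : #|M|.-tuple 'I_m, [/\ uniq s, M =i s &
    s = enum A ++ enum B ++ enum C :> seq 'I_m].
Proof.
move=> /triplesP[_ [AB AC BC ABC]].
have us : uniq (enum A ++ enum B ++ enum C).
  rewrite !uniq_enum_cat ?enum_uniq//.
    by rewrite -[enum C]cats0; exact: disjoint_enum_cat BC (disjoint_nil _).
  apply: disjoint_enum_cat AB _.
  by rewrite -[enum C]cats0; exact: disjoint_enum_cat AC (disjoint_nil _).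
have Ms : M =i enum A ++ enum B ++ enum C.
  by move=> i; rewrite !mem_cat !mem_enum -ABC !inE orbA.
have sk : size (enum A ++ enum B ++ enum C) == #|M|.
  by rewrite (eq_card Ms) (card_uniqP us).
by exists (Tuple sk).
Qed.

(** The last bound holds because I lies in [n] and M in the union of I and J: an element of M beyond
    n belongs to J \ I. *)
Lemma component_pair_split M IJ : component_pair M IJ ->
  [/\ (#|IJ.1 :&: IJ.2| + #|IJ.1 :\: IJ.2| = p)%N,
      (#|IJ.1 :&: IJ.2| + #|IJ.2 :\: IJ.1| = q)%N,
      (#|IJ.1 :&: IJ.2 :&: M| + #|(IJ.1 :&: IJ.2) :\: M| = #|IJ.1 :&: IJ.2|)%N,
      (#|M| = #|IJ.1 :&: IJ.2 :&: M| + #|IJ.1 :\: IJ.2| + #|IJ.2 :\: IJ.1|)%N &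
      (#|M :&: final_seg m n| <= #|IJ.2 :\: IJ.1|)%N]%SET.
Proof.
case: IJ => I J /and4P[/and3P[/= In /eqP Ip /eqP Jq]] IJM JIM MIJ /=.
split.
- by rewrite cardsID.
- by rewrite finset.setIC cardsID.
- by rewrite cardsID.
- rewrite -(cardsID (I :&: J)%SET M) (finset.setIC M) -addnA; congr addn.
  rewrite -(cardsID I (M :\: _)%SET); congr addn; apply: eq_card => i.
    have /implyP := fintype.subsetP IJM i.
    by rewrite !inE; case: (i \in I); case: (i \in J); case: (i \in M).
  have /implyP := fintype.subsetP JIM i; have /implyP := fintype.subsetP MIJ i.
  by rewrite !inE; case: (i \in I); case: (i \in J); case: (i \in M).
- apply/subset_leq_card/fintype.subsetP => i; rewrite !inE => /andP[iM ni].
  have := fintype.subsetP MIJ _ iM; have /implyP := fintype.subsetP In i.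
  by rewrite !inE ltnNge ni implybF => /negbTE ->.
Qed.

(** Shows that the ranges of k, s and r in the formula for U_M miss no contributing pair. *)
Lemma component_pair_card M IJ (k := #|M|)
    (s := #|(M :&: final_seg m n)%SET|) (r := #|(IJ.1 :&: IJ.2)%SET|) :
  (n <= m)%N -> component_pair M IJ ->
  [/\ (k <= p + q)%N, (s <= minn q (minn k (m - n)))%N,
      (uphalf (p + q - k) <= r)%N, (r <= minn p (minn (q - s) (p + q - k)))%N &
      #|((IJ.1 :&: IJ.2) :\: M)%SET| = (p + q - r - k)%N].
Proof.
move=> nm /component_pair_split[]; rewrite -/r -/k -/s.
have sk : (s <= k)%N by apply/subset_leq_card/finset.subsetIl.
have smn : (s <= m - n)%N.
  by rewrite -(card_final_seg nm); apply/subset_leq_card/finset.subsetIr.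
by move=> e1 e2 e3 e4 e5; exact: component_pair_arith e1 e2 e3 e4 e5 sk smn.
Qed.

Lemma pair_triple_in M IJ : component_pair M IJ ->
  pair_triple M IJ \in triples p q #|(IJ.1 :&: IJ.2)%SET| n M.
Proof.
move=> MIJ; have [e1 e2 e3 e4 _] := component_pair_split MIJ.
case: IJ MIJ e1 e2 e3 e4 => I J /and4P[/and3P[/= In _ _] IJM JIM MIJ] e1 e2 e3 e4.
have disj (A B : {set 'I_m}) : (A :&: B = finset.set0)%SET -> [disjoint A & B]%B.
  by rewrite -finset.setI_eq0 => ->.
have [aE bE cE] : [/\ (#|I :&: J :&: M| = 2 * #|I :&: J| + #|M| - p - q)%N,
    (#|I :\: J| = p - #|I :&: J|)%N & (#|J :\: I| = q - #|I :&: J|)%N]%SET.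
  exact: pair_triple_arith e1 e2 e3 e4.
rewrite inE /= /ksubsets !inE; apply/and5P; split.
- apply/andP; split; last exact/eqP/aE.
  by rewrite -finset.setIA finset.subIset ?In.
- apply/andP; split; last exact/eqP/bE.
  by rewrite finset.subDset finset.subsetU ?In ?orbT.
- apply/andP; split; last exact/eqP/cE.
  by apply/fintype.subsetP => i _; rewrite inE.
- apply: disj; apply/setP => i; rewrite !inE.
  by case: (i \in I); case: (i \in J); case: (i \in M).
apply/and3P; split.
- apply: disj; apply/setP => i; rewrite !inE.
  by case: (i \in I); case: (i \in J); case: (i \in M).
- apply: disj; apply/setP => i; rewrite !inE.
  by case: (i \in I); case: (i \in J); case: (i \in M).
apply/eqP/setP => i; have /implyP := fintype.subsetP IJM i.
have /implyP := fintype.subsetP JIM i; have /implyP := fintype.subsetP MIJ i.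
by rewrite !inE; case: (i \in I); case: (i \in J); case: (i \in M).
Qed.

Lemma card_pair_fiber r M T : (n <= m)%N -> (p + q <= n)%N ->
  let k := #|M| in let s := #|(M :&: final_seg m n)%SET| in
  (k <= p + q)%N -> (s <= minn q (minn k (m - n)))%N ->
  (uphalf (p + q - k) <= r)%N -> (r <= minn p (minn (q - s) (p + q - k)))%N ->
  T \in triples p q r n M ->
  #|[set IJ | component_pair M IJ && (#|(IJ.1 :&: IJ.2)%SET| == r) &
              (pair_triple M IJ == T)]%SET| = 'C(n - k + s, p + q - r - k).
Proof.
move=> nm pqn k s kpq sq r1 r2; case: T => [[A B] C] /triplesP[].
move=> [An Bn Ac Bc Cc] [AB AC BC ABC].
have sk : (s <= k)%N by apply/subset_leq_card/finset.subsetIl.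
(* No truncation occurs: k <= p + q <= n. *)
have -> : (n - k + s)%N = #|initial_seg m n :\: M|%SET.
  rewrite cardsD finset.setIC card_initial_part (card_initial_seg nm).
  by rewrite subnBA_le// (leq_trans kpq).
rewrite -cards_draws.
(* The pairs in the fiber differ only in [D], recovered from (I, J) as the common indices outside
   [M]. *)
pose f (D : {set 'I_m}) := (D :|: A :|: B, D :|: A :|: C)%SET.
have ABCi i : (i \in A) || (i \in B) || (i \in C) = (i \in M).
  by rewrite -ABC !inE.
have ABi i : (i \in A) && (i \in B) = false.
  by apply/negP => /andP[iA]; rewrite (disjointFr AB iA).
have ACi i : (i \in A) && (i \in C) = false.
  by apply/negP => /andP[iA]; rewrite (disjointFr AC iA).
have BCi i : (i \in B) && (i \in C) = false.
  by apply/negP => /andP[iB]; rewrite (disjointFr BC iB).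
rewrite -(card_in_imset (f := f)); last first.
  move=> D D'; rewrite !inE => /andP[DM _] /andP[D'M _] [/setP DD' _].
  apply/setP => i; have := DD' i; have := ABCi i.
  have /implyP := fintype.subsetP DM i; have /implyP := fintype.subsetP D'M i.
  rewrite !inE; case: (i \in A); case: (i \in B); case: (i \in M);
    by case: (i \in D); case: (i \in D').
apply: eq_card => -[I J]; rewrite inE; apply/andP/imsetP => /=.
  move=> [/andP[MIJ /eqP IJr] /eqP[IJA IJB JIC]].
  exists ((I :&: J) :\: M)%SET.
    have [_ _ _ _ /= e] := component_pair_card nm MIJ.
    rewrite inE e IJr eqxx andbT.
    case/and4P: MIJ => /and3P[/= In _ _] _ _ _.
    apply/fintype.subsetP => i; have /implyP := fintype.subsetP In i.
    by rewrite !inE; case: (i \in I); case: (i \in M); rewrite ?andbF.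
  rewrite /f -IJA -IJB -JIC; congr pair; apply/setP => i; rewrite !inE.
    by case: (i \in I); case: (i \in J); case: (i \in M).
  by case: (i \in I); case: (i \in J); case: (i \in M).
move=> [D]; rewrite inE => /andP[DM /eqP Dl] [-> ->].
have Di i : i \in D -> (i < n)%N /\ i \in M = false.
  by move/(fintype.subsetP DM); rewrite !inE => /andP[/negbTE -> ->].
have DMi i : (i \in D) && (i \in M) = false.
  by apply/negP => /andP[/Di[_ ->]].
have disj (F G : {set 'I_m}) : (forall i, (i \in F) && (i \in G) = false) ->
    #|F :|: G|%SET = (#|F| + #|G|)%N.
  move=> FG; rewrite cardsU (_ : F :&: G = finset.set0)%SET ?cards0 ?subn0//.
  by apply/setP => i; rewrite !inE FG.
have DAc : #|D :|: A|%SET = r.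
  rewrite disj ?Dl ?Ac => [|i].
    by move: r2; rewrite !leq_min => /and3P[_ _]; exact: contraction_indexK.
  by have := ABCi i; have := DMi i; case: (i \in A); case: (i \in D) => //= ->.
have IJ : ((D :|: A :|: B) :&: (D :|: A :|: C) = D :|: A)%SET.
  apply/setP => i; have := BCi i; rewrite !inE.
  by case: (i \in A); case: (i \in B); case: (i \in C); case: (i \in D).
have IJd : ((D :|: A :|: B) :\: (D :|: A :|: C) = B)%SET.
  apply/setP => i; have := BCi i; have := ABi i; have := DMi i; have := ABCi i.
  rewrite !inE; case: (i \in A); case: (i \in B); case: (i \in C);
  by case: (i \in D) => //= <-.
have JId : ((D :|: A :|: C) :\: (D :|: A :|: B) = C)%SET.
  apply/setP => i; have := BCi i; have := ACi i; have := DMi i; have := ABCi i.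
  rewrite !inE; case: (i \in A); case: (i \in B); case: (i \in C);
  by case: (i \in D) => //= <-.
move: r2; rewrite !leq_min => /and3P[rp rq _].
rewrite /pair_triple /component_pair /base_pair /= IJ IJd JId DAc eqxx andbT.
split; last first.
  apply/eqP; congr (_, _, _); apply/setP => i; have := DMi i; have := ABCi i.
  by rewrite !inE; case: (i \in A); case: (i \in D) => //= <-.
apply/and4P; split.
- apply/and3P; split.
  + rewrite !finset.subUset An Bn !andbT.
    by apply/fintype.subsetP => i /Di[]; rewrite inE.
  + rewrite disj ?DAc ?Bc => [|i]; first by rewrite subnKC.
    have := ABi i; have := DMi i; have := ABCi i; rewrite !inE.
    by case: (i \in A); case: (i \in B); case: (i \in D) => //= <-.
  + rewrite disj ?DAc ?Cc => [|i]; first by rewrite subnKC// (leq_trans rq)// leq_subr.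
    have := ACi i; have := DMi i; have := ABCi i; rewrite !inE.
    by case: (i \in A); case: (i \in B); case: (i \in C); case: (i \in D) => //= <-.
- by apply/fintype.subsetP => i iB; rewrite -ABCi iB orbT.
- by apply/fintype.subsetP => i iC; rewrite -ABCi iC orbT.
- apply/fintype.subsetP => i; rewrite -ABCi !inE.
  by case: (i \in A); case: (i \in B); case: (i \in C); rewrite ?orbT.
Qed.

(** [A] and [B] lie in [n], so [C] contains the s elements of [M] beyond n. What is distributed
    among the three blocks is the part of [M] inside [n], of size k - s, with q - r - s places left
    in [C]. *)
Lemma card_triples r M : (n <= m)%N ->
  let k := #|M| in let s := #|(M :&: final_seg m n)%SET| in
  (k <= p + q)%N -> (s <= minn q (minn k (m - n)))%N ->
  (uphalf (p + q - k) <= r)%N -> (r <= minn p (minn (q - s) (p + q - k)))%N ->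
  (#|triples p q r n M|%:R <=
   multinomial3 R (k - s) (2 * r + k - p - q) (p - r) (q - r - s)).
Proof.
move=> nm k s kpq sq r1 r2; rewrite /multinomial3.
have sk : (s <= k)%N by apply/subset_leq_card/finset.subsetIl.
set a := (2 * r + k - p - q)%N; set b := (p - r)%N; set c := (q - r - s)%N.
have abc : (k - s = a + b + c)%N.
  by apply: triples_arith => //; move: sq; rewrite leq_min => /andP[].
set N := (M :&: initial_seg m n)%SET.
have Nc : #|N| = (k - s)%N by rewrite /N card_initial_part.
(* [C] is what [A] and [B] leave of [M], so it suffices to count the pairs (A, B). *)
have inj : {in triples p q r n M &, injective fst}.
  move=> [[A B] C] [[A' B'] C'] /triplesP[_ [AB AC BC ABC]].
  move=> /triplesP[_ [AB' AC' BC' ABC']] /= [AA' BB']; rewrite -AA' -BB'.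
  congr (_, _, _); move: AC' BC' ABC'; rewrite -AA' -BB' => AC' BC' ABC'.
  apply/setP => i.
  have := congr1 (fun S : {set 'I_m} => i \in S) ABC.
  rewrite -ABC' !inE; move: (disjointFr AC (x := i)) (disjointFr BC (x := i)).
  move: (disjointFr AC' (x := i)) (disjointFr BC' (x := i)).
  case: (i \in A) => /=; first by move=> -> // _ -> //.
  case: (i \in B) => /=; first by move=> _ -> // _ -> //.
  by [].
rewrite -(card_in_imset inj).
pose S := [set AB : {set 'I_m} * {set 'I_m} | [&& AB.1 \subset N, #|AB.1| == a,
             AB.2 \subset N :\: AB.1 & #|AB.2| == b]]%SET.
have sub : (fst @: triples p q r n M)%SET \subset S.
  apply/fintype.subsetP => _ /imsetP[[[A B] C] ABCr ->].
  have [[An Bn Ac Bc Cc] [AB AC BC ABC]] := triplesP ABCr.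
  rewrite inE /= Ac Bc !eqxx andbT/=.
  rewrite /N finset.subsetI An finset.subsetD finset.subsetI Bn !andbT.
  rewrite disjoint_sym AB andbT -ABC -finset.setUA finset.subsetUl/=.
  by rewrite (finset.setUCA A) finset.subsetUl.
have Sc : #|S| = ('C(k - s, a) * 'C(k - s - a, b))%N.
  rewrite -sum1_card (eq_bigl (fun AB : {set 'I_m} * {set 'I_m} =>
      (AB.1 \in [set A : {set 'I_m} | (A \subset N) && (#|A| == a)]%SET) &&
      (AB.2 \in [set B : {set 'I_m} | (B \subset N :\: AB.1) && (#|B| == b)]%SET))).
    rewrite -(pair_big_dep (fun A : {set 'I_m} => A \in
         [set A : {set 'I_m} | (A \subset N) && (#|A| == a)]%SET)
      (fun A B : {set 'I_m} => B \in
         [set B : {set 'I_m} | (B \subset N :\: A) && (#|B| == b)]%SET)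
      (fun _ _ => 1%N))/=.
    rewrite (eq_bigr (fun=> 'C(k - s - a, b))).
      by rewrite sum_nat_const cards_draws Nc.
    move=> A; rewrite inE => /andP[AN /eqP Aa].
    rewrite sum1_card cards_draws cardsD (finset.setIidPr AN) Nc Aa//.
  by move=> [A B]; rewrite !inE /= -!andbA.
apply: (@le_trans _ _ (#|S|%:R)); first by rewrite ler_nat subset_leq_card.
rewrite ler_pdivlMr ?ltr0n ?muln_gt0 ?fact_gt0// -natrM ler_nat Sc.
(* The multinomial coefficient is the product of two binomials: choose [A] among a + b + c elements,
   then [B] among the remaining b + c. *)
rewrite abc -{1}(@bin_fact (a + b + c) a) -?addnA ?leq_addr//.
rewrite addKn -[X in (_ <= _ * (_ * X))%N](@bin_fact (b + c) b) ?leq_addr// addKn.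
by rewrite leq_eqVlt; apply/orP; left; apply/eqP; ring.
Qed.

Hypotheses (mpsi : measurable_fun setT psi) (mphi : measurable_fun setT phi).
Hypotheses (psiS : symmetric_kernel psi) (phiS : symmetric_kernel phi).

Definition triple_component r (M : {set 'I_m})
    (T : {set 'I_m} * {set 'I_m} * {set 'I_m}) (x : m.-tuple E) : R :=
  top_component mu
    (kernel_contraction mu psi phi r (p + q - r - #|M|) #|M|)
    (pt #|M| (subsample x (enum T.1.1 ++ enum T.1.2 ++ enum T.2))).

Lemma triple_component_hproj r M T : T \in triples p q r n M ->
  exists s : #|M|.-tuple 'I_m, [/\ uniq s, M =i s,
    s = enum T.1.1 ++ enum T.1.2 ++ enum T.2 :> seq 'I_m &
    forall x, triple_component r M T x = hproj mu M (fun y =>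
      kernel_contraction mu psi phi r (p + q - r - #|M|) #|M|
        (coords (tnth s) y)) x].
Proof.
case: T => [[A B] C] /triple_tuple[s [us Ms sE]]; exists s; split => // x.
rewrite /triple_component /= -sE pt_subsample.
have mc := @measurable_kernel_contraction _ _ _ mu _ _ _ _ r
  (p + q - r - #|M|) #|M| mpsi mphi.
exact: (top_component_hproj mu x mc us Ms).
Qed.

(** With [D] the common indices outside [M], the unions of [D], [A], [B] and of [D], [A], [C] are
    again I and J, so the contraction is the conditional expectation of this pair's kernel
    product. *)
Lemma triple_componentE M IJ x : (n <= m)%N -> component_pair M IJ ->
  triple_component #|(IJ.1 :&: IJ.2)%SET| M (pair_triple M IJ) x =
  hproj mu M (condE mu M (kernel_product IJ)) x.
Proof.
move=> nm MIJ; have [e1 e2 e3 e4 _] := component_pair_split MIJ.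
have [kpq _ r1 r2 eD] := component_pair_card nm MIJ.
have /triplesP[[_ _ Ac Bc Cc] [AB AC BC ABC]] := pair_triple_in MIJ.
case: IJ MIJ e1 e2 e3 e4 r1 r2 eD Ac Bc Cc AB AC BC ABC => I J MIJ /=.
set r := #|(I :&: J)%SET|; set A := (I :&: J :&: M)%SET.
set B := (I :\: J)%SET; set C := (J :\: I)%SET; set D := ((I :&: J) :\: M)%SET.
move=> e1 e2 e3 e4 r1 r2 eD Ac Bc Cc AB AC BC ABC.
have [s [_ _ /= sE ->]] := triple_component_hproj (pair_triple_in MIJ).
apply: (congr1 (fun h => hproj mu M h x)); apply/funext => y.
rewrite -pt_subsample sE.
have DM : [disjoint D & M]%B.
  rewrite -finset.setI_eq0; apply/eqP/setP => i; rewrite !inE.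
  by case: (i \in M); rewrite /= ?andbF.
have DAB : (D :|: A :|: B = I)%SET.
  apply/setP => i; rewrite !inE.
  by case: (i \in I); case: (i \in J); case: (i \in M).
have DAC : (D :|: A :|: C = J)%SET.
  apply/setP => i; rewrite !inE.
  by case: (i \in I); case: (i \in J); case: (i \in M).
rewrite (@kernel_contraction_condE _ _ _ _ _ _ _ psi phi r _ _ D A B C M) //.
- by rewrite DAB DAC.
- by rewrite -eD -e3 leq_addl.
- by rewrite -e1 leq_addr.
- by rewrite -e2 leq_addr.
- by rewrite -eD -e3 addnK.
- by rewrite -eD; exact: contraction_index_size e1 e2 e3 e4.
Qed.

Lemma triple_component_sample r M T w :
  top_component mu
    (kernel_contraction mu psi phi r (p + q - r - #|M|) #|M|)
    (pt #|M| (sample X T.1.1 w ++ sample X T.1.2 w ++ sample X T.2 w)) =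
  triple_component r M T (sample_tuple X m w).
Proof. by rewrite /triple_component !sample_subsample /subsample !map_cat. Qed.

(** Group the pairs by the size r of their intersection, then by their triple: the summand is
    constant on each fiber, and the fiber size is the binomial factor. *)
Lemma product_componentE M w : (n <= m)%N -> (p + q <= n)%N ->
  product_component mu X psi phi n M w =
  \sum_(IJ | component_pair M IJ)
    hproj mu M (condE mu M (kernel_product IJ)) (sample_tuple X m w).
Proof.
move=> nm pqn; rewrite /product_component; case: ifPn => [/andP[kpq sq]|kN].
  rewrite [RHS](_ : _ = \sum_(uphalf (p + q - #|M|) <= r <
      (minn p (minn (q - #|(M :&: final_seg m n)%SET|) (p + q - #|M|))).+1)
      \sum_(IJ | component_pair M IJ && (#|(IJ.1 :&: IJ.2)%SET| == r))
        hproj mu M (condE mu M (kernel_product IJ)) (sample_tuple X m w)).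
    apply: eq_big_nat => r /andP[r1 r2].
    rewrite (partition_big (pair_triple M) [in triples p q r n M])/=; last first.
      by move=> IJ /andP[MIJ /eqP <-]; exact: pair_triple_in.
    rewrite mulr_sumr; apply: eq_bigr => T Tr.
    rewrite triple_component_sample -(card_pair_fiber nm pqn kpq sq r1 r2 Tr).
    rewrite mulr_natl -sumr_const; apply: eq_big => [IJ|IJ].
      by rewrite inE.
    rewrite inE => /andP[/andP[MIJ /eqP <-] /eqP <-].
    by rewrite triple_componentE.
  rewrite (exchange_big_dep (component_pair M))/= => [|r IJ _ /andP[]//].
  apply: eq_bigr => IJ MIJ; rewrite MIJ/=.
  have [_ _ r1 r2 _] := component_pair_card nm MIJ.
  under eq_bigl do rewrite eq_sym.
  by rewrite big_nat1_eq r1 ltnS r2.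
(* Outside the range of the formula no pair contributes. *)
rewrite big1// => IJ MIJ; exfalso; move: kN.
by have [-> -> _ _ _] := component_pair_card nm MIJ.
Qed.

End ProductComponents.

(** * Sigma-algebras generated by subsamples *)

Section SigmaOf.
Context (R : realType) dO (Omega : measurableType dO) (P : probability Omega R).
Context d (E : measurableType d) (X : nat -> {RV P >-> E}) (m : nat).
Local Notation T := (m.-tuple E).
Implicit Types (L : {set 'I_m}) (c : T).

(** Freezing the coordinates off [L] at a fixed point [c] represents (X_i), i in L, as a point of
    E^m. The sets [B] with preimage in [sigma_of X L] form a sigma-algebra, so one-coordinate
    preimages suffice; for a frozen coordinate the preimage is empty or everything. *)
Lemma sigma_of_splice L c (B : set T) : measurable B ->
  sigma_of X L [set w | B (splice L (sample_tuple X m w) c)].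
Proof.
have sX : sigma_algebra setT (sigma_of X L) by exact: smallest_sigma_algebra.
set f := fun w => splice L (sample_tuple X m w) c.
suff : measurable `<=` image_set_system setT f (sigma_of X L).
  by move=> /[apply]; rewrite /image_set_system/= setTI.
apply: smallest_sub; first exact: sigma_algebra_image.
move=> A; elim/big_ind: _ => //; first by move=> Y Z hY hZ [/hY|/hZ].
move=> i _ [C mC <-]; rewrite /image_set_system /= !setTI.
have [iL|iL] := boolP (i \in L).
  apply: sub_sigma_algebra; exists i => //; exists C => //.
  rewrite setTI; apply/seteqP; split => w /=.
    by rewrite /f tnth_splice iL tnth_mktuple.
  by rewrite /f tnth_splice iL tnth_mktuple.
rewrite (_ : _ @^-1` _ = [set _ | C (tnth c i)]); last first.
  by apply/seteqP; split => w /=; rewrite /f tnth_splice (negbTE iL).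
have [cC|cC] := pselect (C (tnth c i)).
  rewrite (_ : [set _ | _] = setT `\` set0).
    by case: sX => s0 sC _; exact: sC.
  by rewrite setD0; apply/seteqP; split.
rewrite (_ : [set _ | _] = set0); first exact: sigma_algebra0.
by apply/seteqP; split.
Qed.

Lemma sigma_of_preimage L (u : T -> R) (B : set R) :
  depends_on L u -> measurable_fun setT u -> measurable B ->
  sigma_of X L ((fun w => u (sample_tuple X m w)) @^-1` B).
Proof.
move=> uL mu mB; pose c : T := [tuple point | _ < m].
have mC : measurable (u @^-1` B) by rewrite -[X in measurable X]setTI; exact: mu.
have := @sigma_of_splice L c _ mC; congr (sigma_of X L).
by apply/seteqP; split => w /=; rewrite depends_on_splice.
Qed.

Lemma sigma_of_exists L c (A : set Omega) : sigma_of X L A ->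
  exists2 B : set T, measurable B &
    A = [set w | B (splice L (sample_tuple X m w) c)].
Proof.
set f := fun w => splice L (sample_tuple X m w) c.
suff : sigma_of X L `<=` preimage_set_system setT f measurable.
  by move=> /[apply] -[B mB <-]; exists B => //; rewrite setTI.
apply: smallest_sub.
  apply: sigma_algebra_preimage; exact: sigma_algebra_measurable.
move=> _ [i /= iL [C mC <-]]; exists ((fun x => tnth x i) @^-1` C).
  by rewrite -[X in measurable X]setTI; exact: measurable_tnth.
by rewrite !setTI; apply/seteqP; split => w /=;
  rewrite /f tnth_splice iL tnth_mktuple.
Qed.

(** On E^m the indicator of an event in [sigma_of X L] is a bounded function of the coordinates in
    [L], to which projections onto [M] are orthogonal. The finite sum matches the shape of U_M given
    by [product_componentE]. *)
Lemma hproj_cond_exp (mu : probability E R) (M L : {set 'I_m})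
    (I : finType) (Pr : pred I) (h : I -> T -> R) (V : Omega -> R) :
  iid mu X -> ~~ (M \subset L) ->
  (forall i, Pr i -> integrable_real (power_prob mu m) (h i)) ->
  (forall w, V w = \sum_(i | Pr i) hproj mu M (h i) (sample_tuple X m w)) ->
  is_cond_exp P (sigma_of X L) V (cst 0).
Proof.
move=> hX ML hi VE; set Q := power_prob mu m.
have mp : measure_preserving P Q (sample_tuple X m).
  exact: sample_measure_preserving.
pose u x := \sum_(i | Pr i) hproj mu M (h i) x.
have ui : integrable_real Q u.
  by apply: integrable_real_sum => i Pi; exact/integrable_hproj/hi.
have Vu : V = u \o sample_tuple X m by apply/funext.
have sX : sigma_algebra setT (sigma_of X L) by exact: smallest_sigma_algebra.
split.
- apply/Lfun1_integrable; rewrite Vu.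
  exact: (measure_preserving_integrable_real mp ui).
- exact: Lfun_cst.
- move=> B mB; rewrite preimage_cst; case: ifP => _.
    by rewrite -setC0 -setTD; case: sX => s0 sC _; exact: sC.
  by case: sX.
pose c : T := [tuple point | _ < m].
move=> A /(sigma_of_exists c)[B mB ->].
(* Evaluated at the sample this is the indicator of the event, and freezing makes it depend on [L]
   only. *)
pose b : T -> R := fun x => \1_B (splice L x c).
have mb : measurable_fun setT b.
  apply: (@measurableT_comp _ _ _ _ _ _ (\1_B : T -> R)).
    exact: measurable_indic.
  exact: measurable_splicel.
have b1 x : `|b x| <= 1 by exact: indic_le1.
have bL : depends_on L b.
  move=> x y xy; congr (\1_B _ : R); apply/eq_from_tnth => i.
  by rewrite !tnth_splice; case: ifPn => // /xy.
have bu : integrable_real Q (fun x => b x * u x).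
  exact: (integrable_real_mul_bounded mb b1 ui).
have bu0 : \int[Q]_x (b x * u x) = 0.
  under eq_Rintegral do rewrite mulr_sumr.
  have or i : Pr i -> integrable_real Q (fun x => b x * hproj mu M (h i) x) /\
      \int[Q]_x (b x * hproj mu M (h i) x) = 0.
    move=> Pi; apply: (hproj_orthogonal ML bL mb).
      exact: integrable_real_measurable (hi _ Pi).
    by move=> K; exact: (pairable_bounded K mb b1 (hi _ Pi)).
  rewrite Rintegral_sum => [|i /or[]//].
  by apply: big1 => i /or[].
transitivity (\int[P]_w (b (sample_tuple X m w) * u (sample_tuple X m w))%:E)%E.
  rewrite integral_mkcond; apply: eq_integral => w _.
  rewrite patchE /b Vu /= indicE.
  have [Bw|Bw] := pselect (B (splice L (sample_tuple X m w) c)).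
    by rewrite !mem_set//= mul1r.
  by rewrite !memNset//= mul0r.
rewrite -(measure_preserving_integral mp (g := fun x => (b x * u x)%:E)).
  rewrite integral0; move: bu0; rewrite /Rintegral => bu0.
  by rewrite -[LHS]fineK ?bu0//; exact: integrable_fin_num.
exact: measurable_int bu.
Qed.

End SigmaOf.

(** * The Hoeffding decomposition *)

Section ProductOfJstats.
Context (R : realType) dO (Omega : measurableType dO) (P : probability Omega R).
Context d (E : measurableType d) (mu : probability E R).
Context (X : nat -> {RV P >-> E}) (hX : iid mu X) (m n p q : nat).
Context (psi : p.-tuple E -> R) (phi : q.-tuple E -> R).
Hypothesis psi2 : psi \in Lfun (power_prob mu p) 2%:E.
Hypothesis phi2 : phi \in Lfun (power_prob mu q) 2%:E.
Hypotheses (psiS : symmetric_kernel psi) (phiS : symmetric_kernel phi).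
Hypotheses (psiD : degenerate mu psi) (phiD : degenerate mu phi).
Hypotheses (nm : (n <= m)%N) (pqn : (p + q <= n)%N).
Local Notation Q := (power_prob mu).
Local Notation pairs := ({set 'I_m} * {set 'I_m})%type.
Local Notation kp := (kernel_product psi phi).
Local Notation U := (product_component mu X psi phi n).
Implicit Types (M : {set 'I_m}) (IJ : pairs).

Let mpsi : measurable_fun setT psi.
Proof. by case/andP: psi2; rewrite inE. Qed.

Let mphi : measurable_fun setT phi.
Proof. by case/andP: phi2; rewrite inE. Qed.

Lemma integrable_kernel_product IJ : base_pair n p q IJ ->
  integrable_real (Q m) (kp IJ).
Proof.
move=> /and3P[_ /eqP Ip /eqP Jq]; apply/Lfun1_integrable.
apply: (@Lfun2_mul_Lfun1 _ _ _ _ (kernel_at psi IJ.1) (kernel_at phi IJ.2)).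
  exact: kernel_at_Lfun2.
exact: kernel_at_Lfun2.
Qed.

(** If [M] misses an index read by just one kernel, degeneracy of that kernel kills every [condE K]
    with K inside M. If [M] has an index read by neither kernel, the alternating sum cancels. *)
Lemma hproj_kernel_product0 M IJ : base_pair n p q IJ ->
  ~~ component_pair n p q M IJ ->
  {ae Q m, forall x, hproj mu M (kp IJ) x = 0}.
Proof.
move=> IJb; have kpi := integrable_kernel_product IJb.
have /and3P[_ /eqP Ip /eqP Jq] := IJb.
have mI : measurable_fun setT (@kernel_at _ E R m _ psi IJ.1).
  by case/andP: (kernel_at_Lfun2 Ip psi2); rewrite inE.
have mJ : measurable_fun setT (@kernel_at _ E R m _ phi IJ.2).
  by case/andP: (kernel_at_Lfun2 Jq phi2); rewrite inE.
have dep (F : {set 'I_m}) i k (f : k.-tuple E -> R) : i \notin F ->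
    depends_on [set~ i]%SET (kernel_at f F).
  move=> iF; apply: (depends_onS _ (@depends_on_kernel_at _ _ _ _ _ f F)).
  by apply/fintype.subsetP => j jF; rewrite !inE; apply: contraNneq iF => <-.
rewrite /component_pair IJb /= !negb_and => /or3P[/subsetPn[i]|/subsetPn[i]|
  /subsetPn[i iM]].
- rewrite inE => /andP[iJ iI] iM; apply: condE_eq0_hproj => // K KM.
  have iK : i \notin K by apply: contra iM; exact: fintype.subsetP.
  have := condE_null iK (dep _ _ _ phi iJ) mI mJ.
  rewrite (_ : (fun x => _ * _) = kp IJ); last first.
    by apply/funext => x; rewrite mulrC.
  by apply => //; exact: degenerate_condE.
- rewrite inE => /andP[iI iJ] iM; apply: condE_eq0_hproj => // K KM.
  have iK : i \notin K by apply: contra iM; exact: fintype.subsetP.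
  apply: (condE_null iK (dep _ _ _ psi iI) mJ mI) => //.
  exact: degenerate_condE.
- rewrite inE negb_or => /andP[iI iJ].
  rewrite (hproj_depends0 mu iM); first exact: aeW.
  by move=> x y xy; congr (_ * _); [exact: (dep _ _ _ psi iI)|
                                    exact: (dep _ _ _ phi iJ)].
Qed.

Lemma Jstat_product w : Jstat X n psi w * Jstat X m phi w =
  \sum_(IJ : pairs | base_pair n p q IJ) kp IJ (sample_tuple X m w).
Proof.
rewrite (Jstat_sets X _ nm psiS) (Jstat_sets X _ (leqnn m) phiS).
rewrite big_distrlr /= pair_big; apply: eq_big => // -[I J] /=.
rewrite /base_pair /= -andbA; congr [&& _, _ & _].
rewrite (_ : J \subset _)//; apply/fintype.subsetP => i _.
by rewrite inE ltn_ord.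
Qed.

(** Each kernel product is the sum of its projections. The exceptional sets for the finitely many
    [M] and [IJ] are merged on E^m and pulled back through the sample. *)
Lemma product_component_sum :
  {ae P, forall w, Jstat X n psi w * Jstat X m phi w =
                   \sum_(M : {set 'I_m}) U M w}.
Proof.
have mp : measure_preserving P (Q m) (sample_tuple X m).
  exact: sample_measure_preserving.
have : {ae Q m, forall x M IJ, base_pair n p q IJ ->
    hproj mu M (condE mu M (kp IJ)) x = hproj mu M (kp IJ) x /\
    (~~ component_pair n p q M IJ -> hproj mu M (kp IJ) x = 0)}.
  apply: filter_forall => M; apply: filter_forall => IJ.
  have [IJb|IJb] := boolP (base_pair n p q IJ); last exact: aeW.
  have h1 := hproj_condE M (integrable_kernel_product IJb).
  have [MIJ|MIJ] := boolP (component_pair n p q M IJ).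
    by apply: filterS h1 => x ->.
  by apply: filterS2 h1 (hproj_kernel_product0 IJb MIJ) => x -> ->.
move/(measure_preserving_ae mp); apply: filterS => w wE.
under [RHS]eq_bigr do rewrite product_componentE//.
rewrite Jstat_product [RHS](exchange_big_dep (base_pair n p q))/=; last first.
  by move=> M IJ _ /andP[].
apply: eq_bigr => IJ IJb; rewrite -(hproj_sum mu (kp IJ)).
rewrite [LHS](bigID (fun M => component_pair n p q M IJ))/= addrC big1 ?add0r.
  by apply: eq_bigr => M _; have [-> _] := wE M _ IJb.
by move=> M MIJ; have [_ ->] := wE M _ IJb.
Qed.

(** For a contributing pair, k is at least the size of I \ J plus that of J \ I, and these two sizes
    differ by |p - q|. *)
Lemma product_component_eq0 M w : ~~ [&& (absz (p%:Z - q%:Z) <= #|M|)%N,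
    (#|M| <= p + q)%N &
    (#|M :&: final_seg m n|%SET <= minn q (minn #|M| (m - n)))%N] ->
  U M w = 0.
Proof.
move=> MN; rewrite product_componentE// big1// => IJ MIJ; exfalso.
move: MN; have [-> -> _ _ _] := component_pair_card nm MIJ.
rewrite !andbT; have [+ + _ + _] := component_pair_split MIJ.
by lia.
Qed.

Lemma product_component_sum_by_type w :
  \sum_(M : {set 'I_m} | (#|M| <= p + q)%N) U M w =
  \sum_(absz (p%:Z - q%:Z) <= k < (p + q).+1)
    \sum_(0 <= s < (minn q (minn k (m - n))).+1)
      \sum_(M : {set 'I_m} | (#|M| == k) &&
                             (#|(M :&: final_seg m n)%SET| == s)) U M w.
Proof.
transitivity (\sum_(absz (p%:Z - q%:Z) <= k < (p + q).+1)
    \sum_(M : {set 'I_m} | #|M| == k) U M w).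
  rewrite [RHS](exchange_big_dep predT)//= big_mkcond; apply: eq_bigr => M _.
  under [RHS]eq_bigl do rewrite eq_sym.
  rewrite big_nat1_eq ltnS; have [M2|M2] := boolP (#|M| <= p + q)%N.
    case: ifPn => //; rewrite andbT => M1.
    by rewrite product_component_eq0// (negbTE M1).
  by rewrite andbF.
apply: eq_big_nat => k /andP[k1 k2].
rewrite (exchange_big_dep (fun M => #|M| == k))/=; last by move=> s M _ /andP[].
apply: eq_bigr => M /eqP Mk; rewrite Mk eqxx/=.
under eq_bigl do rewrite eq_sym.
rewrite big_nat1_eq /=; case: ifPn => //; rewrite ltnS => /negbTE sN.
by rewrite product_component_eq0// Mk sN !andbF.
Qed.

Lemma product_component_hoeffding :
  Hoeffding_decomposition X (fun w => Jstat X n psi w * Jstat X m phi w)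
    (fun M : {set 'I_m} => U M).
Proof.
pose u M (x : m.-tuple E) := \sum_(IJ | component_pair n p q M IJ)
    hproj mu M (condE mu M (kp IJ)) x.
have UE M : U M = fun w => u M (sample_tuple X m w).
  by apply/funext => w; rewrite product_componentE.
have ki M IJ : component_pair n p q M IJ ->
    integrable_real (Q m) (condE mu M (kp IJ)).
  by move=> /and4P[IJb _ _ _]; exact/integrable_condE/integrable_kernel_product.
split; first exact: product_component_sum.
- move=> M B mB.
  have du : depends_on M (u M).
    move=> x y xy; apply: eq_bigr => IJ _.
    exact: (@depends_on_hproj _ _ _ mu _ M _ x y xy).
  have umf : measurable_fun setT (u M).
    apply: (@integrable_real_measurable _ _ _ (Q m)).
    by apply: integrable_real_sum => IJ MIJ; exact/integrable_hproj/ki.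
  by have := sigma_of_preimage (X := X) du umf mB; rewrite -UE.
- move=> M L ML; apply: (hproj_cond_exp hX ML (ki M)) => w.
  by rewrite product_componentE.
Qed.

End ProductOfJstats.

(** * The variance bound *)

Section VarianceBound.
Context (R : realType) dO (Omega : measurableType dO) (P : probability Omega R).
Context d (E : measurableType d) (mu : probability E R).
Context (X : nat -> {RV P >-> E}) (hX : iid mu X) (m n p q : nat).
Context (psi : p.-tuple E -> R) (phi : q.-tuple E -> R).
Hypotheses (mpsi : measurable_fun setT psi) (mphi : measurable_fun setT phi).
Hypotheses (nm : (n <= m)%N) (pqn : (p + q <= n)%N).
Local Notation Q := (power_prob mu).
Implicit Types (M : {set 'I_m}).

(** Evaluating the contraction at distinct coordinates keeps its L^2 norm, and projecting onto [M]
    does not increase it. *)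
Lemma triple_component_norm r M T
    (f := kernel_contraction mu psi phi r (p + q - r - #|M|) #|M|) :
  T \in triples p q r n M -> f \in Lfun (Q #|M|) 2%:E ->
  triple_component mu psi phi r M T \in Lfun (Q m) 2%:E /\
  ('N[Q m]_2%:E[EFin \o triple_component mu psi phi r M T] <=
   'N[Q #|M|]_2%:E[EFin \o f])%E.
Proof.
move=> Tr f2; have [s [us Ms _ HE]] := triple_component_hproj mu mpsi mphi Tr.
have sI : injective (tnth s) by exact/tuple_uniqP.
have smp := coords_measure_preserving mu sI.
have mf : measurable_fun setT f by exact: measurable_kernel_contraction.
pose F (y : m.-tuple E) := f (coords (tnth s) y).
have F2 : F \in Lfun (Q m) 2%:E by exact: (measure_preserving_Lfun smp f2).
have FM : depends_on M F.
  move=> x y xy; congr f; apply/eq_from_tnth => i; rewrite !tnth_coords.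
  by apply: xy; rewrite Ms mem_tnth.
have {}HE : triple_component mu psi phi r M T = hproj mu M F by apply/funext.
have H2 := hproj_Lfun2 M F2.
rewrite HE; split => //.
rewrite -(measure_preserving_Lnorm smp 2 mf); apply: le_Lnorm2 => //.
exact: hproj_contraction.
Qed.

(** If all contractions are in L^2, the standard deviation is at most the L^2 norm, to which the
    triangle inequality applies; otherwise the right-hand side is infinite. *)
Lemma sqrte_variance_product_component M :
  let k := #|M| in let s := #|(M :&: final_seg m n)%SET| in
  (k <= p + q)%N -> (s <= minn q (minn k (m - n)))%N ->
  (sqrte 'V_P[product_component mu X psi phi n M] <=
   \sum_(uphalf (p + q - k) <= r < (minn p (minn (q - s) (p + q - k))).+1)
     ('C(n - k + s, p + q - r - k)%:R *
      multinomial3 R (k - s) (2 * r + k - p - q) (p - r) (q - r - s))%:E *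
     'N[Q k]_2%:E
       [EFin \o kernel_contraction mu psi phi r (p + q - r - k) k])%E.
Proof.
move=> k s kpq sq.
pose f r := kernel_contraction mu psi phi r (p + q - r - k) k.
pose c r : R := 'C(n - k + s, p + q - r - k)%:R *
      multinomial3 R (k - s) (2 * r + k - p - q) (p - r) (q - r - s).
set lo := uphalf (p + q - k).
set hi := (minn p (minn (q - s) (p + q - k))).+1.
have sk : (s <= k)%N by apply/subset_leq_card/finset.subsetIl.
(* Strict positivity matters when a norm is infinite: a zero coefficient would annihilate it. *)
have c0 r : (lo <= r < hi)%N -> 0 < c r.
  move=> /andP[r1 r2]; rewrite mulr_gt0//.
    by rewrite ltr0n bin_gt0; move: kpq pqn; clear; lia.
  rewrite divr_gt0 ?ltr0n ?fact_gt0//.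
  by rewrite !muln_gt0 !fact_gt0.
have mf r : measurable_fun setT (f r) by exact: measurable_kernel_contraction.
have [foo|[r [rb roo]]] : (forall r, (lo <= r < hi)%N -> f r \in Lfun (Q k) 2%:E) \/
    exists r, (lo <= r < hi)%N /\ 'N[Q k]_2%:E[EFin \o f r]%E = +oo%E.
  have [[r [rb roo]]|N] := pselect (exists r, (lo <= r < hi)%N /\
      'N[Q k]_2%:E[EFin \o f r]%E = +oo%E); first by right; exists r.
  left => r rb; apply/andP; split; rewrite inE/= /finite_norm//.
  by rewrite ltey; apply/eqP => roo; apply: N; exists r.
- pose g (rT : nat) x := \sum_(T in triples p q rT n M)
    triple_component mu psi phi rT M T x.
  have gP r : (lo <= r < hi)%N -> g r \in Lfun (Q m) 2%:E /\
      ('N[Q m]_2%:E[EFin \o g r] <=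
       (multinomial3 R (k - s) (2 * r + k - p - q) (p - r) (q - r - s))%:E *
       'N[Q k]_2%:E[EFin \o f r])%E.
    move=> rb; have [r1 r2] := andP rb.
    have [|g2 gN] := @Lfun2_sum _ _ _ (Q m) _
      (index_enum ({set 'I_m} * {set 'I_m} * {set 'I_m})%type)
      [in triples p q r n M] (triple_component mu psi phi r M).
      by move=> T Tr; have [] := triple_component_norm Tr (foo r rb).
    split => //; apply: (le_trans gN).
    apply: (@le_trans _ _ (\sum_(T in triples p q r n M)
        1%:E * 'N[Q k]_2%:E[EFin \o f r])%E).
      apply: lee_sum => T Tr; rewrite mul1e.
      by have [] := triple_component_norm Tr (foo r rb).
    rewrite -ge0_sume_distrl// sumEFin sumr_const.
    apply: lee_wpmul2r; first exact: Lnorm_ge0.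
    by rewrite lee_fin; exact: card_triples.
  (* The range of r is repeated as a filter, in the form produced by [big_nat_cond], because [g r]
     is known to be in L^2 only for r in that range. *)
  pose u x := \sum_(lo <= r < hi | (lo <= r < hi)%N && true)
    'C(n - k + s, p + q - r - k)%:R * g r x.
  have [|u2 uN] := @Lfun2_sum _ _ _ (Q m) _ (index_iota lo hi)
    (fun r => (lo <= r < hi)%N && true)
    (fun r x => 'C(n - k + s, p + q - r - k)%:R * g r x).
    by move=> r /andP[rb _]; apply: Lfun2_scale; have [] := gP r rb.
  have mp : measure_preserving P (Q m) (sample_tuple X m).
    exact: sample_measure_preserving.
  have UE : product_component mu X psi phi n M = u \o sample_tuple X m.
    apply/funext => w; rewrite /product_component kpq sq /= /u [LHS]big_nat_cond.
    apply: eq_bigr => r _; rewrite (eq_bigr (fun T =>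
      triple_component mu psi phi r M T (sample_tuple X m w))) => [//|T _].
    by rewrite triple_component_sample.
  have U2 := measure_preserving_Lfun mp u2.
  rewrite UE; apply: (le_trans (sqrte_variance_le U2)).
  have mu' : measurable_fun setT u by case/andP: u2; rewrite inE.
  rewrite (measure_preserving_Lnorm mp 2 mu'); apply: (le_trans uN).
  rewrite [leRHS]big_nat_cond; apply: lee_sum => r /andP[rb _].
  have [g2 gN] := gP r rb.
  by rewrite Lnorm2_scale// EFinM -muleA; apply: lee_wpmul2l; rewrite ?lee_fin.
- rewrite [leRHS](_ : _ = +oo%E) ?leey//.
  (* The term of infinite norm is isolated; the others are nonnegative, so the sum is infinite. *)
  rewrite (bigD1_seq r) ?mem_index_iota ?iota_uniq//= -/(c r) -/(f r) roo.
  rewrite gt0_muley ?lte_fin ?c0// addye// -ltNye.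
  apply: (@lt_le_trans _ _ 0%E) => //; rewrite big_nat_cond.
  apply: sume_ge0 => j /andP[jb _]; apply: mule_ge0; last exact: Lnorm_ge0.
  by rewrite lee_fin ltW// c0.
Qed.

End VarianceBound.

Theorem proposition5p1 (R : realType)
    (dO : measure_display) (Omega : measurableType dO) (P : probability Omega R)
    (d : measure_display) (E : measurableType d) (mu : probability E R)
    (X : nat -> {RV P >-> E}) (hX : iid mu X)
    (p q : nat) (hp : (1 <= p)%N) (hq : (1 <= q)%N)
    (psi : p.-tuple E -> R) (phi : q.-tuple E -> R)
    (psiL2 : psi \in Lfun (power_prob mu p) 2%:E)
    (phiL2 : phi \in Lfun (power_prob mu q) 2%:E)
    (psiS : symmetric_kernel psi) (phiS : symmetric_kernel phi)
    (psiD : degenerate mu psi) (phiD : degenerate mu phi)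
    (n m : nat) (hn : (p <= n)%N) (hm : (q <= m)%N) (hnm : (n <= m)%N)
    (hpq : (p + q <= n)%N) :
  let T := fun w => Jstat X n psi w * Jstat X m phi w in
  let U := fun M : {set 'I_m} => product_component mu X psi phi n M in
  [/\ Hoeffding_decomposition X T U,
      {ae P, forall w, T w = \sum_(M : {set 'I_m} | (#|M| <= p + q)%N) U M w},
      forall w, \sum_(M : {set 'I_m} | (#|M| <= p + q)%N) U M w =
        \sum_(absz (p%:Z - q%:Z) <= k < (p + q).+1)
          \sum_(0 <= s < (minn q (minn k (m - n))).+1)
            \sum_(M : {set 'I_m} | (#|M| == k) &&
                                   (#|(M :&: final_seg m n)%SET| == s)) U M w &
      forall (M : {set 'I_m}) (k s : nat),
        k = #|M| -> s = #|(M :&: final_seg m n)%SET| ->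
        (k <= p + q)%N -> (s <= minn q (minn k (m - n)))%N ->
        (sqrte 'V_P[U M] <=
         \sum_(uphalf (p + q - k) <= r < (minn p (minn (q - s) (p + q - k))).+1)
           ('C(n - k + s, p + q - r - k)%:R *
            multinomial3 R (k - s) (2 * r + k - p - q) (p - r) (q - r - s))%:E *
           'N[power_prob mu k]_2%:E
             [EFin \o kernel_contraction mu psi phi r (p + q - r - k) k])%E].
Proof.
split.
- exact: product_component_hoeffding.
- apply: filterS (product_component_sum hX psiL2 phiL2 psiS phiS psiD phiD
    hnm hpq) => w ->.
  rewrite [RHS]big_mkcond; apply: eq_bigr => M _; case: ifPn => // Mpq.
  by rewrite product_component_eq0// (negbTE Mpq) !andbF.
- by move=> w; exact: product_component_sum_by_type.
- move=> M k s -> ->; apply: sqrte_variance_product_component => //.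
    by case/andP: psiL2; rewrite inE.
  by case/andP: phiL2; rewrite inE.
Qed.
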